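(* Let $k$ be an algebraically closed field, let $X$ be a closed subscheme of $\mathbb{A}^N_k$ and suppose that its ideal $I_X\subset k[x_1,\ldots,x_N]$ is generated by $m$ polynomials, with $m<N$. Then $[\mathcal{L}_n(X)]$ is a multiple of $\mathbb{L}^{\lceil (N-m+1)(n/2)\rceil}$ in $K_0(\mathrm{Var}_k)$ for all $n\in\mathbb{Z}_{\ge0}$.
   Context: $k$ has arbitrary characteristic. $\mathcal{L}_n(X)$ is the scheme of $n$-jets of $X$: it represents the functor $Y\mapsto \mathrm{Hom}_k(Y\times_{\mathrm{Spec}\,k}\mathrm{Spec}\,k[t]/(t^{n+1}),X)$ on $k$-schemes. It is endowed with its reduced structure when taking its class. The Grothendieck ring $K_0(\mathrm{Var}_k)$ is the abelian group generated by symbols $[V]$, for $V$ an algebraic variety over $k$, subject to $[V]=[V']$ if $V\cong V'$ and $[V]=[V\setminus W]+[W]$ if $W$ is closed in $V$; its multiplication is given by $[V]\cdot[W]=[V\times W]$. $\mathbb{L}$ is the class of the affine line. *)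

(* Defs.v *)
From Stdlib Require Ring_theory.
From HB Require Import structures.
From mathcomp Require Import all_boot all_order all_algebra.
From mathcomp Require Import qpoly mpoly.
From mathcomp Require Import boolp classical_sets functions topology.

Set Implicit Arguments.
Unset Strict Implicit.
Unset Printing Implicit Defensive.

Import GRing.Theory.
Local Open Scope classical_set_scope.
Local Open Scope ring_scope.

Lemma near_all (T : topologicalType) (x : T) (P : T -> Prop) :
  (forall y, P y) -> \forall y \near x, P y.
Proof. exact: nearW. Qed.

Lemma near_comp (S T : topologicalType) (f : S -> T) (x : S) (P : T -> Prop) :
  continuous f -> (\forall y \near f x, P y) -> \forall z \near x, P (f z).
Proof. by move=> cf /(cf x). Qed.

Lemma near_and (T : topologicalType) (x : T) (P Q : T -> Prop) :
  (\forall y \near x, P y) -> (\forall y \near x, Q y) ->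
  \forall y \near x, P y /\ Q y.
Proof. exact: filterI. Qed.

Section Space.
Variable k : closedFieldType.

(* A sheaf of k-valued functions, given by its germs: f is a section over an
   open set U when [regular x f] holds for all x in U.  The values of f away
   from x are irrelevant ([regular_eq]), so f may be taken total. *)
Record space := Space {
  points :> topologicalType;
  regular : points -> (points -> k) -> Prop;
  regular_near : forall x f, regular x f -> \forall y \near x, regular y f;
  regular_eq : forall x f g,
    (\forall y \near x, f y = g y) -> regular x f -> regular x g;
  regular_cst : forall x c, regular x (fun=> c);
  regularD : forall x f g,
    regular x f -> regular x g -> regular x (fun y => f y + g y);
  regularM : forall x f g,
    regular x f -> regular x g -> regular x (fun y => f y * g y);
  regular_neq0 : forall x f,
    regular x f -> f x != 0 -> \forall y \near x, f y != 0;
  regularV : forall x f,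
    regular x f -> f x != 0 -> regular x (fun y => (f y)^-1)
}.

Definition morphism (X Y : space) (phi : X -> Y) :=
  continuous phi /\ forall x g, regular (phi x) g -> regular x (g \o phi).

Definition isomorphic (X Y : space) :=
  exists (phi : X -> Y) (psi : Y -> X),
    [/\ morphism phi, morphism psi, cancel phi psi & cancel psi phi].

Lemma morphism_id (X : space) : morphism (@id X).
Proof. by split => // x A. Qed.

Lemma morphism_comp (X Y Z : space) (f : X -> Y) (g : Y -> Z) :
  morphism f -> morphism g -> morphism (g \o f).
Proof.
move=> [cf rf] [cg rg]; split=> [x|x h /rg/rf //].
by apply: continuous_comp; [exact: cf | exact: cg].
Qed.

Lemma isomorphic_refl X : isomorphic X X.
Proof. by exists id, id; split=> //; exact: morphism_id. Qed.

Lemma isomorphic_sym X Y : isomorphic X Y -> isomorphic Y X.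
Proof. by move=> [f [g [? ? ? ?]]]; exists g, f. Qed.

Lemma isomorphic_trans Y X Z :
  isomorphic X Y -> isomorphic Y Z -> isomorphic X Z.
Proof.
move=> [f [g [mf mg fK gK]]] [f' [g' [mf' mg' f'K g'K]]].
by exists (f' \o f), (g \o g'); split;
  [exact: morphism_comp | exact: morphism_comp | exact: can_comp
  | exact: can_comp].
Qed.

Section Restriction.
Variables (X : space) (A : set X).

Let reg (a : A) (f : A -> k) := exists2 g,
  regular (val a : X) g & \forall b \near a, f b = g (val b).

Let val_cont : continuous (val : A -> X).
Proof. exact: initial_continuous. Qed.

Let pull (a : A) (P : X -> Prop) :
  (\forall y \near (val a : X), P y) -> \forall b \near a, P (val b).
Proof. by move=> nP; apply: (val_cont nP). Qed.

Let reg_near a f : reg a f -> \forall b \near a, reg b f.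
Proof.
case=> g rg fg.
have := pull (regular_near rg); have := near_join fg.
by apply: filterS2 => b fg' rg'; exists g.
Qed.

Let reg_eq a f g : (\forall b \near a, f b = g b) -> reg a f -> reg a g.
Proof.
move=> fg [h rh fh]; exists h => //.
by move: fg fh; apply: filterS2 => b ->.
Qed.

Let reg_cst a c : reg a (fun=> c).
Proof.
exists (fun=> c); first exact: regular_cst.
exact: near_all.
Qed.

Let regD a f g : reg a f -> reg a g -> reg a (fun b => f b + g b).
Proof.
move=> [f' rf ff] [g' rg gg]; exists (fun y => f' y + g' y).
  exact: regularD.
by move: ff gg; apply: filterS2 => b -> ->.
Qed.

Let regM a f g : reg a f -> reg a g -> reg a (fun b => f b * g b).
Proof.
move=> [f' rf ff] [g' rg gg]; exists (fun y => f' y * g' y).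
  exact: regularM.
by move: ff gg; apply: filterS2 => b -> ->.
Qed.

Let reg_neq0 a f : reg a f -> f a != 0 -> \forall b \near a, f b != 0.
Proof.
move=> [g rg fg]; rewrite (nbhs_singleton fg) => /(regular_neq0 rg)/pull.
by move: fg; apply: filterS2 => b ->.
Qed.

Let regV a f : reg a f -> f a != 0 -> reg a (fun b => (f b)^-1).
Proof.
move=> [g rg fg]; rewrite (nbhs_singleton fg) => ga.
exists (fun y => (g y)^-1); first exact: regularV.
by move: fg; apply: filterS => b ->.
Qed.

(* The reduced induced structure on a locally closed A. *)
Definition restriction : space := @Space A reg reg_near reg_eq reg_cst
  regD regM reg_neq0 regV.

Lemma regular_restrictionE (a : restriction) f : regular a f <->
  exists2 g, regular (val a : X) g & \forall b \near a, f b = g (val b).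
Proof. by []. Qed.

Lemma morphism_val : morphism (val : restriction -> X).
Proof.
split; first exact: val_cont.
by move=> a g rg; exists g => //; apply: near_all.
Qed.

Lemma morphism_to_restriction (Z : space) (phi : Z -> restriction) :
  morphism (val \o phi : Z -> X) -> morphism phi.
Proof.
move=> [cphi rphi].
have cp : continuous phi.
  apply/continuousP => _ [B oB <-].
  by rewrite -comp_preimage; move/continuousP: cphi; apply.
split=> // z f [g rg fg]; apply: regular_eq (rphi _ _ rg).
by move: (near_comp cp fg); apply: filterS => y /= ->.
Qed.

End Restriction.

Section Affine_space.
Variable d : nat.

Definition affine_pt := 'rV[k]_d.
HB.instance Definition _ := Choice.on affine_pt.

Definition zariski_open : set (set affine_pt) := [set U |
  forall x : affine_pt, U x -> exists2 p : {mpoly k[d]}, p.@[x 0] != 0 &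
    forall y : affine_pt, p.@[y 0] != 0 -> U y].

Let zariskiT : zariski_open setT.
Proof. by move=> x _; exists 1; rewrite ?meval1 ?oner_eq0. Qed.

Let zariskiI : setI_closed zariski_open.
Proof.
move=> U V oU oV x [/oU [p px pU] /oV [q qx qV]]; exists (p * q).
  by rewrite mevalM mulf_neq0.
by move=> y; rewrite mevalM mulf_eq0 negb_or => /andP[/pU ? /qV].
Qed.

Let zariski_bigU (I : Type) (U : I -> set affine_pt) :
  (forall i, zariski_open (U i)) -> zariski_open (\bigcup_i U i).
Proof.
move=> oU x [i _ /oU [p px pU]]; exists p => // y /pU ?.
by exists i.
Qed.

HB.instance Definition _ :=
  isOpenTopological.Build affine_pt zariskiT zariskiI zariski_bigU.

Lemma nbhs_affineE (x : affine_pt) (U : set affine_pt) : nbhs x U <->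
  exists2 p : {mpoly k[d]}, p.@[x 0] != 0 & forall y : affine_pt, p.@[y 0] != 0 -> U y.
Proof.
split=> [[V [oV Vx VU]]|[p px pU]].
  by have [p px pV] := oV _ Vx; exists p => // y /pV /VU.
exists [set y : affine_pt | p.@[y 0] != 0]; split=> //.
by move=> y py; exists p.
Qed.

Let reg (x : affine_pt) (f : affine_pt -> k) :=
  exists p q : {mpoly k[d]}, q.@[x 0] != 0 /\
    \forall y \near x, f y = p.@[(y : affine_pt) 0] / q.@[(y : affine_pt) 0].

Let near_neq0 (p : {mpoly k[d]}) (x : affine_pt) :
  p.@[x 0] != 0 -> \forall y \near x, p.@[(y : affine_pt) 0] != 0.
Proof. by move=> px; apply/nbhs_affineE; exists p. Qed.

Let reg_near x f : reg x f -> \forall y \near x, reg y f.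
Proof.
move=> [p [q [/near_neq0 qx fpq]]].
have := near_join fpq; move: qx; apply: filterS2 => y qy fy.
by exists p, q.
Qed.

Let reg_eq x f g : (\forall y \near x, f y = g y) -> reg x f -> reg x g.
Proof.
move=> fg [p [q [qx fpq]]]; exists p, q; split=> //.
by move: fg fpq; apply: filterS2 => y ->.
Qed.

Let reg_poly x (p : {mpoly k[d]}) : reg x (fun y => p.@[y 0]).
Proof.
exists p, 1; rewrite meval1 oner_eq0; split=> //.
by apply: near_all => y; rewrite meval1 divr1.
Qed.

Let reg_cst x c : reg x (fun=> c).
Proof.
apply: reg_eq (reg_poly x c%:MP); apply: near_all => y; exact: mevalC.
Qed.

Let regD x f g : reg x f -> reg x g -> reg x (fun y => f y + g y).
Proof.
move=> [p [q [qx fpq]]] [p' [q' [qx' fpq']]].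
exists (p * q' + p' * q), (q * q'); rewrite mevalM mulf_neq0 //; split=> //.
move: (near_neq0 qx) (near_neq0 qx') => nq nq'.
have nn := near_and nq nq'; move: nn fpq fpq'.
by apply: filterS3 => y [qy qy'] -> ->; rewrite mevalD !mevalM addf_div.
Qed.

Let regM x f g : reg x f -> reg x g -> reg x (fun y => f y * g y).
Proof.
move=> [p [q [qx fpq]]] [p' [q' [qx' fpq']]].
exists (p * p'), (q * q'); rewrite mevalM mulf_neq0 //; split=> //.
by move: fpq fpq'; apply: filterS2 => y -> ->; rewrite !mevalM mulf_div.
Qed.

Let reg_neq0 x f : reg x f -> f x != 0 -> \forall y \near x, f y != 0.
Proof.
move=> [p [q [qx fpq]]]; rewrite (nbhs_singleton fpq) mulf_eq0 negb_or.
move=> /andP[/near_neq0 px _].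
by move: (near_neq0 qx) px fpq; apply: filterS3 => y qy py ->;
  rewrite mulf_neq0 ?invr_eq0.
Qed.

Let regV x f : reg x f -> f x != 0 -> reg x (fun y => (f y)^-1).
Proof.
move=> [p [q [qx fpq]]]; rewrite (nbhs_singleton fpq) mulf_eq0 negb_or.
move=> /andP[px _]; exists q, p; split=> //.
by move: fpq; apply: filterS => y ->; rewrite invf_div.
Qed.

Definition affine_space : space := @Space affine_pt reg reg_near reg_eq
  reg_cst regD regM reg_neq0 regV.

Lemma regular_affineE (x : affine_space) f : regular x f <->
  exists p q : {mpoly k[d]}, q.@[(x : affine_pt) 0] != 0 /\
    \forall y \near x, f y = p.@[(y : affine_pt) 0] / q.@[(y : affine_pt) 0].
Proof. by []. Qed.

Lemma regular_poly (x : affine_space) (p : {mpoly k[d]}) :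
  regular x (fun y : affine_pt => p.@[y 0]).
Proof. exact: reg_poly. Qed.

Lemma regular_meval (Z : space) (z : Z) (phi : Z -> affine_space) p :
    (forall i, regular z (fun y => (phi y : affine_pt) 0 i)) ->
  regular z (fun y => p.@[(phi y : affine_pt) 0]).
Proof.
move=> rphi; elim/mpolyind: p => [|c m p _ _ ih].
  by apply: regular_eq (regular_cst _ 0); apply: near_all => y; rewrite meval0.
apply: (@regular_eq _ _
  (fun y => c * \prod_(i < d) (phi y : affine_pt) 0 i ^+ m i
            + p.@[(phi y : affine_pt) 0])).
  by apply: near_all => y; rewrite mevalD mevalZ mevalX.
apply: regularD => //; apply: regularM; first exact: regular_cst.
pose P (F : Z -> k) := regular z F.
have regX f : P f -> forall e, P (fun y => f y ^+ e).
  move=> rf; elim=> [|e ihe].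
    by apply: regular_eq (regular_cst _ 1); apply: near_all => y; rewrite expr0.
  apply: regular_eq (regularM rf ihe); apply: near_all => y; exact/esym/exprS.
have regP (s : seq 'I_d) :
    P (fun y => \prod_(i <- s) (phi y : affine_pt) 0 i ^+ m i).
  elim: s => [|i s ihs].
    by apply: regular_eq (regular_cst _ 1); apply: near_all => y; rewrite big_nil.
  apply: regular_eq (regularM (regX _ (rphi i) (m i)) ihs).
  by apply: near_all => y; rewrite big_cons.
exact: regP.
Qed.

Lemma morphism_to_affine (Z : space) (phi : Z -> affine_space) :
    (forall z i, regular z (fun y => (phi y : affine_pt) 0 i)) ->
  morphism phi.
Proof.
move=> rphi.
have cphi : continuous phi.
  move=> z U /nbhs_affineE [p pz pU].
  have := regular_neq0 (regular_meval p (rphi z)) pz.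
  by apply: filterS => y /pU.
split=> // z f [p [q [qz fpq]]].
apply: (@regular_eq _ _
  (fun y => p.@[(phi y : affine_pt) 0] / q.@[(phi y : affine_pt) 0])).
  by move: (near_comp cphi fpq); apply: filterS => y /= ->.
apply: regularM; first exact: regular_meval.
by apply: regularV; [exact: regular_meval | ].
Qed.

Lemma regular_coord (Z : space) (phi : Z -> affine_space) :
  morphism phi -> forall z i, regular z (fun y => (phi y : affine_pt) 0 i).
Proof.
move=> [_ rphi] z i; have := rphi z _ (regular_poly (phi z) 'X_i).
by apply: regular_eq; apply: near_all => y /=; rewrite mevalXU.
Qed.

Lemma closed_zeros (S : set {mpoly k[d]}) :
  closed ([set x | forall p, S p -> p.@[(x : affine_pt) 0] = 0]
          : set affine_space).
Proof.
rewrite -openC openE => x /existsNP[p /not_implyP[Sp /eqP px]].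
by apply/nbhs_affineE; exists p => // y py /(_ p Sp)/eqP; rewrite (negPf py).
Qed.

End Affine_space.

Section Product.
Variables X Y : space.

Definition product_pt : Type := (X * Y)%type.
HB.instance Definition _ := Choice.on product_pt.

(* The image of O_x (x) O_y in the functions near z = (x, y). *)
Inductive tensor (z : product_pt) : (product_pt -> k) -> Prop :=
| tensor_fst f : regular z.1 f -> tensor z (fun w => f w.1)
| tensor_snd g : regular z.2 g -> tensor z (fun w => g w.2)
| tensorD f g : tensor z f -> tensor z g -> tensor z (fun w => f w + g w)
| tensorM f g : tensor z f -> tensor z g -> tensor z (fun w => f w * g w).

(* The Zariski topology of the product, not the product topology: basic open
   sets are the loci in rectangles where a function in [tensor] is nonzero. *)
Definition product_open : set (set product_pt) :=
  [set W | forall z, W z -> exists U V h,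
    [/\ nbhs z.1 U, nbhs z.2 V, tensor z h, h z != 0 &
        forall w, U w.1 -> V w.2 -> h w != 0 -> W w]].

Let tensor_cst z c : tensor z (fun=> c).
Proof. by apply: (@tensor_fst z (fun=> c)); exact: regular_cst. Qed.

Let productT : product_open setT.
Proof.
move=> z _; exists setT, setT, (fun=> 1); split=> //; try exact: filterT.
exact: oner_neq0.
Qed.

Let productI : setI_closed product_open.
Proof.
move=> W W' oW oW' z [/oW[U [V [h [nU nV th hz hW]]]]].
move=> /oW'[U' [V' [h' [nU' nV' th' hz' hW']]]].
exists (U `&` U'), (V `&` V'), (fun w => h w * h' w).
split; [exact: filterI | exact: filterI | exact: tensorM
       | exact: mulf_neq0 |].
move=> w [? ?] [? ?]; rewrite mulf_eq0 negb_or => /andP[? ?].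
by split; [exact: hW | exact: hW'].
Qed.

Let product_bigU (I : Type) (W : I -> set product_pt) :
  (forall i, product_open (W i)) -> product_open (\bigcup_i W i).
Proof.
move=> oW z [i _ /oW[U [V [h [nU nV th hz hW]]]]].
by exists U, V, h; split=> // w Uw Vw hw; exists i => //; exact: hW.
Qed.

HB.instance Definition _ :=
  isOpenTopological.Build product_pt productT productI product_bigU.

Let rect_near (z : product_pt) (U : X -> Prop) (V : Y -> Prop) :
  (\forall x \near z.1, U x) -> (\forall y \near z.2, V y) ->
  \forall w \near z, U (w : product_pt).1 /\ V (w : product_pt).2.
Proof.
rewrite /prop_near1 !nbhsE => -[U' [oU' U'z] U'U] [V' [oV' V'z] V'V].
exists [set w : product_pt | U' w.1 /\ V' w.2]; last first.
  by move=> w [Uw Vw]; split; [exact: U'U | exact: V'V].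
split=> //; suff: product_open [set w | U' w.1 /\ V' w.2] by [].
move=> w [Uw Vw]; exists U', V', (fun=> 1); split=> //.
- exact: open_nbhs_nbhs.
- exact: open_nbhs_nbhs.
- exact: oner_neq0.
Qed.

Let tensor_near z h : tensor z h -> \forall w \near z, tensor w h.
Proof.
elim=> [f rf|g rg|f g _ ihf _ ihg|f g _ ihf _ ihg].
- have := rect_near (regular_near rf) (near_all _ (fun _ => Logic.I)).
  by apply: filterS => w [rw _]; exact: tensor_fst.
- have := rect_near (near_all _ (fun _ => Logic.I)) (regular_near rg).
  by apply: filterS => w [_ rw]; exact: tensor_snd.
- by move: ihf ihg; apply: filterS2 => w; exact: tensorD.
- by move: ihf ihg; apply: filterS2 => w; exact: tensorM.
Qed.

Lemma nbhs_productE (z : product_pt) (W : set product_pt) : nbhs z W <->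
  exists U V h, [/\ nbhs z.1 U, nbhs z.2 V, tensor z h, h z != 0 &
    forall w, U w.1 -> V w.2 -> h w != 0 -> W w].
Proof.
split=> [[W' [oW' W'z W'W]]|].
  have {}oW' : product_open W' := oW'.
  have [U [V [h [nU nV th hz hW]]]] := oW' z W'z.
  by exists U, V, h; split=> // w ? ? ?; apply/W'W/hW.
move=> [U [V [h [nU nV th hz hW]]]].
have [T [oT Tz Tt]] : nbhs z [set w | tensor w h] := tensor_near th.
have [R [oR Rz RUV]] := rect_near nU nV.
exists (T `&` R `&` [set w | h w != 0]); split=> //.
  move=> w [[Tw Rw] hw].
  have oTR : product_open (T `&` R) by exact: productI.
  have [U' [V' [h' [nU' nV' th' hz' hW']]]] := oTR w (conj Tw Rw).
  exists U', V', (fun w => h w * h' w); split=> //.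
  - by apply: tensorM => //; exact: Tt.
  - exact: mulf_neq0.
  - move=> v Uv Vv; rewrite mulf_eq0 negb_or => /andP[hv hv'].
    by split=> //; exact: hW'.
by move=> w [[_ /RUV[Uw Vw]] hw]; exact: hW.
Qed.

Let near_neq0 z h : tensor z h -> h z != 0 -> \forall w \near z, h w != 0.
Proof.
move=> th hz; apply/nbhs_productE; exists setT, setT, h.
by split=> //; exact: filterT.
Qed.

Let reg (z : product_pt) (f : product_pt -> k) := exists h h',
  [/\ tensor z h, tensor z h', h' z != 0 & \forall w \near z, f w = h w / h' w].

Let reg_near z f : reg z f -> \forall w \near z, reg w f.
Proof.
move=> [h [h' [th th' hz' fh]]].
have nn := near_and (near_neq0 th' hz') (near_join fh).
move: (tensor_near th) (tensor_near th') nn.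
by apply: filterS3 => w tw tw' [hw' fw]; exists h, h'.
Qed.

Let reg_eq z f g : (\forall w \near z, f w = g w) -> reg z f -> reg z g.
Proof.
move=> fg [h [h' [th th' hz' fh]]]; exists h, h'; split=> //.
by move: fg fh; apply: filterS2 => w ->.
Qed.

Let reg_tensor z h : tensor z h -> reg z h.
Proof.
move=> th; exists h, (fun=> 1); split=> //; first exact: oner_neq0.
by apply: near_all => w; rewrite divr1.
Qed.

Let reg_cst z c : reg z (fun=> c).
Proof. exact/reg_tensor/tensor_cst. Qed.

Let regD z f g : reg z f -> reg z g -> reg z (fun w => f w + g w).
Proof.
move=> [p [q [tp tq qz fpq]]] [p' [q' [tp' tq' qz' fpq']]].
exists (fun w => p w * q' w + p' w * q w), (fun w => q w * q' w); split.
- by apply: tensorD; exact: tensorM.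
- exact: tensorM.
- exact: mulf_neq0.
have nn := near_and (near_neq0 tq qz) (near_neq0 tq' qz'); move: nn fpq fpq'.
by apply: filterS3 => y [qy qy'] -> ->; rewrite addf_div.
Qed.

Let regM z f g : reg z f -> reg z g -> reg z (fun w => f w * g w).
Proof.
move=> [p [q [tp tq qz fpq]]] [p' [q' [tp' tq' qz' fpq']]].
exists (fun w => p w * p' w), (fun w => q w * q' w); split.
- exact: tensorM.
- exact: tensorM.
- exact: mulf_neq0.
by move: fpq fpq'; apply: filterS2 => y -> ->; rewrite mulf_div.
Qed.

Let reg_neq0 z f : reg z f -> f z != 0 -> \forall w \near z, f w != 0.
Proof.
move=> [p [q [tp tq qz fpq]]]; rewrite (nbhs_singleton fpq) mulf_eq0 negb_or.
move=> /andP[/(near_neq0 tp) pz _].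
by move: (near_neq0 tq qz) pz fpq; apply: filterS3 => y qy py ->;
  rewrite mulf_neq0 ?invr_eq0.
Qed.

Let regV z f : reg z f -> f z != 0 -> reg z (fun w => (f w)^-1).
Proof.
move=> [p [q [tp tq qz fpq]]]; rewrite (nbhs_singleton fpq) mulf_eq0 negb_or.
move=> /andP[pz _]; exists q, p; split=> //.
by move: fpq; apply: filterS => y ->; rewrite invf_div.
Qed.

Definition product : space := @Space product_pt reg reg_near reg_eq
  reg_cst regD regM reg_neq0 regV.

Lemma regular_productE (z : product) f : regular z f <-> exists h h',
  [/\ tensor z h, tensor z h', h' z != 0 & \forall w \near z, f w = h w / h' w].
Proof. by []. Qed.

Lemma regular_tensor (z : product) h : tensor z h -> regular z h.
Proof. exact: reg_tensor. Qed.

Lemma morphism_fst : morphism (fst : product -> X).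
Proof.
split; last by move=> z f rf; exact/regular_tensor/(tensor_fst rf).
by move=> z U nU; have := rect_near nU (near_all _ (fun _ => Logic.I)); apply: filterS => w [].
Qed.

Lemma morphism_snd : morphism (snd : product -> Y).
Proof.
split; last by move=> z f rf; exact/regular_tensor/(tensor_snd rf).
by move=> z U nU; have := rect_near (near_all _ (fun _ => Logic.I)) nU; apply: filterS => w [].
Qed.

Lemma morphism_to_product (Z : space) (phi : Z -> product) :
  morphism (fst \o phi : Z -> X) -> morphism (snd \o phi : Z -> Y) ->
  morphism phi.
Proof.
move=> [c1 r1] [c2 r2].
have rt z h : tensor (phi z) h -> regular z (h \o phi).
  elim=> [f rf|g rg|f g _ ihf _ ihg|f g _ ihf _ ihg].
  - exact: r1 rf.
  - exact: r2 rg.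
  - exact: regularD.
  - exact: regularM.
have cphi : continuous phi.
  move=> z W /nbhs_productE[U [V [h [nU nV th hz hW]]]].
  move: (near_comp c1 nU) (near_comp c2 nV) (regular_neq0 (rt _ _ th) hz).
  by apply: filterS3 => y; exact: hW.
split=> // z f [h [h' [th th' hz fh]]].
apply: (@regular_eq _ _ (fun y => h (phi y) / h' (phi y))).
  by move: (near_comp cphi fh); apply: filterS => y /= ->.
apply: regularM; first exact: rt.
by apply: regularV; [exact: rt | ].
Qed.

End Product.

Definition separated (X : space) :=
  closed [set z : product X X | z.1 = z.2].

Definition is_affine (X : space) := exists d (Z : set (affine_space d)),
  closed Z /\ isomorphic X (restriction Z).

(* Over the algebraically closed field k, these spaces are the sets of closed
   points of the reduced (possibly reducible) separated k-schemes of finite type,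
   with their sheaves of regular functions. *)
Definition is_variety (X : space) := separated X /\
  exists (I : finType) (U : I -> set X), [/\ forall i, open (U i),
    \bigcup_i U i = setT & forall i, is_affine (restriction (U i))].

Record variety := Variety { variety_space :> space;
                            varietyP : is_variety variety_space }.

Lemma isomorphic_restriction (X Y : space) (f : X -> Y) (g : Y -> X)
    (A : set X) (B : set Y) :
    morphism f -> morphism g -> cancel f g -> cancel g f ->
    (forall x, A x <-> B (f x)) ->
  isomorphic (restriction A) (restriction B).
Proof.
move=> mf mg fK gK AB.
have fP (a : restriction A) : f (val a) \in B.
  by rewrite inE; apply/AB/set_valP.
have gP (b : restriction B) : g (val b) \in A.
  by rewrite inE; apply/AB; rewrite gK; exact: set_valP.
exists (fun a => SigSub (fP a)), (fun b => SigSub (gP b)); split.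
- apply: morphism_to_restriction.
  exact: morphism_comp (morphism_val A) mf.
- apply: morphism_to_restriction.
  exact: morphism_comp (morphism_val B) mg.
- by move=> a; apply: val_inj => /=; rewrite fK.
- by move=> b; apply: val_inj => /=; rewrite gK.
Qed.

Lemma restrictionT (X : space) (A : set X) :
  A = setT -> isomorphic (restriction A) X.
Proof.
move=> ->; have inT (x : X) : x \in [set: X] by rewrite inE.
exists val, (fun x => SigSub (inT x)); split=> //.
- exact: morphism_val.
- apply: morphism_to_restriction; exact: morphism_id.
- by move=> a; exact: val_inj.
Qed.

Lemma product_restriction (X Y : space) (A : set X) (B : set Y) :
  isomorphic (product (restriction A) (restriction B))
    (restriction ([set z | A z.1 /\ B z.2] : set (product X Y))).
Proof.
set AB := ([set z | A z.1 /\ B z.2] : set (product X Y)).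
have fP (z : product (restriction A) (restriction B)) :
    ((val z.1, val z.2) : product X Y) \in AB.
  by rewrite inE; split; exact: set_valP.
have g1P (w : restriction AB) : (val w).1 \in A.
  by rewrite inE; have [] := set_valP w.
have g2P (w : restriction AB) : (val w).2 \in B.
  by rewrite inE; have [] := set_valP w.
exists (fun z => SigSub (fP z)),
  (fun w => (SigSub (g1P w), SigSub (g2P w))); split.
- apply: morphism_to_restriction; apply: morphism_to_product.
  + exact: morphism_comp (morphism_fst _ _) (morphism_val A).
  + exact: morphism_comp (morphism_snd _ _) (morphism_val B).
- apply: morphism_to_product; apply: morphism_to_restriction.
  + exact: morphism_comp (morphism_val AB) (morphism_fst _ _).
  + exact: morphism_comp (morphism_val AB) (morphism_snd _ _).
- by move=> [a b]; congr pair; exact: val_inj.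
- by move=> w; apply: val_inj => /=; case: (val w).
Qed.

Lemma isomorphic_product (X X' Y Y' : space) :
  isomorphic X X' -> isomorphic Y Y' ->
  isomorphic (product X Y) (product X' Y').
Proof.
move=> [f [g [mf mg fK gK]]] [f' [g' [mf' mg' fK' gK']]].
exists (fun z => (f z.1, f' z.2)), (fun z => (g z.1, g' z.2)); split.
- apply: morphism_to_product.
  + exact: morphism_comp (morphism_fst _ _) mf.
  + exact: morphism_comp (morphism_snd _ _) mf'.
- apply: morphism_to_product.
  + exact: morphism_comp (morphism_fst _ _) mg.
  + exact: morphism_comp (morphism_snd _ _) mg'.
- by move=> [x y] /=; rewrite fK fK'.
- by move=> [x y] /=; rewrite gK gK'.
Qed.

Lemma productC (X Y : space) : isomorphic (product X Y) (product Y X).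
Proof.
by exists (fun z => (z.2, z.1)), (fun z => (z.2, z.1)); split;
  try (by case); apply: morphism_to_product;
  [exact: morphism_snd | exact: morphism_fst
  |exact: morphism_snd | exact: morphism_fst].
Qed.

Lemma productA (X Y Z : space) :
  isomorphic (product X (product Y Z)) (product (product X Y) Z).
Proof.
exists (fun w => ((w.1, w.2.1), w.2.2)), (fun w => (w.1.1, (w.1.2, w.2)));
  split; try (by move=> [? [? ?]]); try (by move=> [[? ?] ?]).
- apply: morphism_to_product; first apply: morphism_to_product.
  + exact: morphism_fst.
  + exact: morphism_comp (morphism_snd _ _) (morphism_fst _ _).
  + exact: morphism_comp (morphism_snd _ _) (morphism_snd _ _).
- apply: morphism_to_product; last apply: morphism_to_product.
  + exact: morphism_comp (morphism_fst _ _) (morphism_fst _ _).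
  + exact: morphism_comp (morphism_fst _ _) (morphism_snd _ _).
  + exact: morphism_snd.
Qed.

Lemma product_affine_space0 (X : space) :
  isomorphic (product (affine_space 0) X) X.
Proof.
exists snd, (fun x => (0 : 'rV[k]_0, x)); split.
- exact: morphism_snd.
- apply: morphism_to_product; last exact: morphism_id.
  by apply: morphism_to_affine => z [].
- by move=> [v x] /=; congr pair; rewrite (thinmx0 v).
- by [].
Qed.

Lemma product_affine_space (a b : nat) :
  isomorphic (product (affine_space a) (affine_space b)) (affine_space (a + b)).
Proof.
have mid := regular_coord (@morphism_id (affine_space (a + b))).
exists (fun z => row_mx (z.1 : 'rV[k]_a) (z.2 : 'rV[k]_b)),
  (fun x => (lsubmx (x : 'rV[k]_(a + b)), rsubmx (x : 'rV[k]_(a + b)))); split.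
- apply: morphism_to_affine => z i; case: (split_ordP i) => j ->.
  + apply: regular_eq (regular_coord (morphism_fst _ _) z j).
    by apply: near_all => w; rewrite row_mxEl.
  + apply: regular_eq (regular_coord (morphism_snd _ _) z j).
    by apply: near_all => w; rewrite row_mxEr.
- apply: morphism_to_product; apply: morphism_to_affine => x i.
  + apply: regular_eq (mid x (lshift b i)).
    by apply: near_all => w; rewrite mxE.
  + apply: regular_eq (mid x (rshift a i)).
    by apply: near_all => w; rewrite mxE.
- by move=> [x y] /=; rewrite row_mxKl row_mxKr.
- by move=> x /=; rewrite hsubmxK.
Qed.

Lemma closed_preimage (X Y : topologicalType) (f : X -> Y) (B : set Y) :
  continuous f -> closed B -> closed (f @^-1` B).
Proof. by move=> /continuous_closedP; apply. Qed.

Lemma closed_rectangle (X Y : space) (A : set X) (B : set Y) :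
  closed A -> closed B ->
  closed ([set z | A z.1 /\ B z.2] : set (product X Y)).
Proof.
move=> cA cB; apply: (@closedI (product X Y)
  ((fst : product X Y -> X) @^-1` A) ((snd : product X Y -> Y) @^-1` B)).
- exact: closed_preimage (morphism_fst X Y).1 cA.
- exact: closed_preimage (morphism_snd X Y).1 cB.
Qed.

Lemma open_rectangle (X Y : space) (A : set X) (B : set Y) :
  open A -> open B -> open ([set z | A z.1 /\ B z.2] : set (product X Y)).
Proof.
move=> cA cB; apply: (@openI (product X Y)
  ((fst : product X Y -> X) @^-1` A) ((snd : product X Y -> Y) @^-1` B)).
- by move/continuousP: (morphism_fst X Y).1; apply.
- by move/continuousP: (morphism_snd X Y).1; apply.
Qed.

Lemma is_affine_iso (X Y : space) : isomorphic X Y -> is_affine Y -> is_affine X.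
Proof.
move=> XY [d [Z [cZ YZ]]]; exists d, Z; split=> //.
exact: isomorphic_trans XY YZ.
Qed.

Lemma is_affine_product (X Y : space) :
  is_affine X -> is_affine Y -> is_affine (product X Y).
Proof.
move=> [a [Z [cZ XZ]]] [b [W [cW YW]]].
apply: is_affine_iso (isomorphic_product XZ YW) _.
apply: is_affine_iso (product_restriction _ _) _.
have [f [g [mf mg fK gK]]] := product_affine_space a b.
pose ZW := [set z | Z z.1 /\ W z.2] : set (product _ _).
exists (a + b)%N, (g @^-1` ZW); split.
  exact: closed_preimage mg.1 (closed_rectangle cZ cW).
by apply: (isomorphic_restriction mf mg fK gK) => x /=; rewrite fK.
Qed.

Lemma separated_inj (X Y : space) (f : X -> Y) :
  morphism f -> injective f -> separated Y -> separated X.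
Proof.
move=> mf fI sY.
pose ff (z : product X X) : product Y Y := (f z.1, f z.2).
have mff : morphism ff.
  apply: morphism_to_product.
  + exact: morphism_comp (morphism_fst _ _) mf.
  + exact: morphism_comp (morphism_snd _ _) mf.
have := closed_preimage mff.1 sY; congr closed.
by apply/seteqP; split=> z /= => [/fI|->].
Qed.

Lemma separated_product (X Y : space) :
  separated X -> separated Y -> separated (product X Y).
Proof.
move=> sX sY; pose P := product X Y.
pose ff1 (z : product P P) : product X X := (z.1.1, z.2.1).
pose ff2 (z : product P P) : product Y Y := (z.1.2, z.2.2).
have mff1 : morphism ff1.
  apply: morphism_to_product.
  + exact: morphism_comp (morphism_fst _ _) (morphism_fst _ _).
  + exact: morphism_comp (morphism_snd _ _) (morphism_fst _ _).
have mff2 : morphism ff2.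
  apply: morphism_to_product.
  + exact: morphism_comp (morphism_fst _ _) (morphism_snd _ _).
  + exact: morphism_comp (morphism_snd _ _) (morphism_snd _ _).
have := closedI (closed_preimage mff1.1 sX) (closed_preimage mff2.1 sY).
congr closed; apply/seteqP; split=> -[[x y] [x' y']] /=.
  by move=> [/= -> ->].
by move=> [-> ->].
Qed.

Lemma separated_affine_space d : separated (affine_space d).
Proof.
rewrite /separated -openC openE => z /eqP zN.
have [i zi] : exists i, (z.1 : 'rV[k]_d) 0 i - (z.2 : 'rV[k]_d) 0 i != 0.
  apply/not_existsP => zE; move/negP: zN; apply; apply/eqP/rowP => i.
  by apply/eqP; rewrite -subr_eq0; apply/negPn/negP/zE.
pose P := product (affine_space d) (affine_space d).
have r1 := regular_coord (morphism_fst _ _ : morphism (fst : P -> _)) z i.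
have r2 := regular_coord (morphism_snd _ _ : morphism (snd : P -> _)) z i.
have := regular_neq0 (regularD r1 (regularM (regular_cst z (-1)) r2)).
rewrite mulN1r => /(_ zi); apply: filterS => w wi /= wE.
by move: wi; rewrite wE mulN1r subrr eqxx.
Qed.

Lemma is_variety_product (X Y : space) :
  is_variety X -> is_variety Y -> is_variety (product X Y).
Proof.
move=> [sX [I [U [oU UT aU]]]] [sY [J [V [oV VT aV]]]].
split; first exact: separated_product.
exists (I * J)%type, (fun ij => [set z | U ij.1 z.1 /\ V ij.2 z.2]); split.
- by move=> ij; exact: open_rectangle.
- apply/seteqP; split=> // -[x y] _.
  have [i _ Ui] : (\bigcup_i U i) x by rewrite UT.
  have [j _ Vj] : (\bigcup_j V j) y by rewrite VT.
  by exists (i, j).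
- move=> ij; apply: is_affine_iso (is_affine_product (aU ij.1) (aV ij.2)).
  exact/isomorphic_sym/product_restriction.
Qed.

Lemma is_affine_variety d (Z : set (affine_space d)) :
  closed Z -> is_variety (restriction Z).
Proof.
move=> cZ; split.
  apply: (@separated_inj (restriction Z) _ (val : restriction Z -> affine_space d)).
  - exact: morphism_val.
  - exact: val_inj.
  - exact: separated_affine_space.
exists unit, (fun=> setT); split.
- by move=> _; exact: openT.
- by apply/seteqP; split=> // x _; exists tt.
- by move=> _; exists d, Z; split=> //; exact: restrictionT.
Qed.

Lemma is_variety_affine_space d : is_variety (affine_space d).
Proof.
split; first exact: separated_affine_space.
exists unit, (fun=> setT); split.
- by move=> _; exact: openT.
- by apply/seteqP; split=> // x _; exists tt.
- move=> _; exists d, setT; split; first exact: closedT.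
  exact: isomorphic_refl.
Qed.

Definition affine_variety d := Variety (is_variety_affine_space d).

Definition product_variety (V W : variety) :=
  Variety (is_variety_product (varietyP V) (varietyP W)).

End Space.

Section GrothendieckRing.
Variable k : closedFieldType.

Inductive K0_word :=
| K0_gen of variety k
| K0_zeroW
| K0_oppW of K0_word
| K0_addW of K0_word & K0_word.

(* In the scissor relation, the subsets W and ~` W of a variety always are
   varieties; V1 and V2 range over their representatives as such. *)
Inductive K0_rel : K0_word -> K0_word -> Prop :=
| K0_refl u : K0_rel u u
| K0_sym u v : K0_rel u v -> K0_rel v u
| K0_trans u v w : K0_rel u v -> K0_rel v w -> K0_rel u w
| K0_opp_congr u v : K0_rel u v -> K0_rel (K0_oppW u) (K0_oppW v)
| K0_add_congr u u' v v' : K0_rel u u' -> K0_rel v v' ->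
    K0_rel (K0_addW u v) (K0_addW u' v')
| K0_addA u v w : K0_rel (K0_addW u (K0_addW v w)) (K0_addW (K0_addW u v) w)
| K0_addC u v : K0_rel (K0_addW u v) (K0_addW v u)
| K0_add0 u : K0_rel (K0_addW K0_zeroW u) u
| K0_addN u : K0_rel (K0_addW u (K0_oppW u)) K0_zeroW
| K0_iso (V V' : variety k) :
    isomorphic V V' -> K0_rel (K0_gen V) (K0_gen V')
| K0_scissor (V V1 V2 : variety k) (W : set V) : closed W ->
    isomorphic V1 (restriction (~` W)) -> isomorphic V2 (restriction W) ->
    K0_rel (K0_gen V) (K0_addW (K0_gen V1) (K0_gen V2)).

(* The quotient of [K0_word] by [K0_rel], as a set of equivalence classes.  It
   lives in a universe above that of the types carrying structures over k, which
   is also that of eqTypes and zmodTypes; hence generic_quotient does not apply,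
   and the ring structure is the one of [K0_ring_theory] below. *)
Record K0 := K0_Class {
  K0_mem : K0_word -> Prop;
  K0_memP : exists u, K0_mem = K0_rel u
}.

Definition K0_of (u : K0_word) : K0 := K0_Class (ex_intro _ u (erefl (K0_rel u))).

Definition K0_repr (a : K0) : K0_word := sval (cid (K0_memP a)).

Lemma K0_ofP u v : K0_of u = K0_of v <-> K0_rel u v.
Proof.
split=> [[uv]|uv]; first by rewrite uv; exact: K0_refl.
have E : K0_rel u = K0_rel v.
  apply/funext => w; apply/propext; split; last exact: K0_trans.
  exact/K0_trans/K0_sym.
by rewrite /K0_of; case: _ / E (ex_intro _ v _) => e; congr K0_Class;
  exact: Prop_irrelevance.
Qed.

Lemma K0_reprK a : K0_of (K0_repr a) = a.
Proof.
case: a => A AP; rewrite /K0_repr /=; case: cid => u /= Au.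
by move: AP; rewrite Au => AP; congr K0_Class; exact: Prop_irrelevance.
Qed.

Lemma K0_repr_of u : K0_rel (K0_repr (K0_of u)) u.
Proof. by apply/K0_ofP; exact: K0_reprK. Qed.

Fixpoint K0_mulgenW (V : variety k) (v : K0_word) : K0_word :=
  match v with
  | K0_gen W => K0_gen (product_variety V W)
  | K0_zeroW => K0_zeroW
  | K0_oppW v1 => K0_oppW (K0_mulgenW V v1)
  | K0_addW v1 v2 => K0_addW (K0_mulgenW V v1) (K0_mulgenW V v2)
  end.

Fixpoint K0_mulW (u v : K0_word) : K0_word :=
  match u with
  | K0_gen V => K0_mulgenW V v
  | K0_zeroW => K0_zeroW
  | K0_oppW u1 => K0_oppW (K0_mulW u1 v)
  | K0_addW u1 u2 => K0_addW (K0_mulW u1 v) (K0_mulW u2 v)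
  end.

Definition K0_class (V : variety k) : K0 := K0_of (K0_gen V).
Definition K0_zero : K0 := K0_of K0_zeroW.
Definition K0_one : K0 := K0_class (affine_variety k 0).
Definition K0_opp (a : K0) : K0 := K0_of (K0_oppW (K0_repr a)).
Definition K0_add (a b : K0) : K0 := K0_of (K0_addW (K0_repr a) (K0_repr b)).
Definition K0_sub (a b : K0) : K0 := K0_add a (K0_opp b).
Definition K0_mul (a b : K0) : K0 := K0_of (K0_mulW (K0_repr a) (K0_repr b)).
Definition K0_exp (a : K0) (e : nat) : K0 := iter e (K0_mul a) K0_one.

Definition lefschetz : K0 := K0_class (affine_variety k 1).

Local Notation "u ~ v" := (K0_rel u v) (at level 70).

Let gen_congr V v v' : v ~ v' -> K0_mulgenW V v ~ K0_mulgenW V v'.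
Proof.
elim=> {v v'} /= [u|u v _ ih|u v w _ ih1 _ ih2|u v _ ih|u u' v v' _ ih1 _ ih2
  |u v w|u v|u|u|W W' WW'|W W1 W2 A cA iW1 iW2].
- exact: K0_refl.
- exact: K0_sym.
- exact: K0_trans ih1 ih2.
- exact: K0_opp_congr.
- exact: K0_add_congr.
- exact: K0_addA.
- exact: K0_addC.
- exact: K0_add0.
- exact: K0_addN.
- apply: K0_iso; exact: isomorphic_product (isomorphic_refl V) WW'.
- pose B := (snd : product V W -> W) @^-1` A.
  have iB (C : set W) (W' : variety k) : isomorphic W' (restriction C) ->
      isomorphic (product V W')
        (restriction ((snd : product V W -> W) @^-1` C)).
    move=> iW'; apply: isomorphic_trans
      (isomorphic_product (isomorphic_sym (restrictionT (erefl [set: V]))) iW') _.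
    apply: isomorphic_trans (product_restriction _ _) _.
    rewrite (_ : [set z | _] = (snd : product V W -> W) @^-1` C).
      exact: isomorphic_refl.
    by apply/seteqP; split=> z /= => [[]|].
  apply: (@K0_scissor _ _ _ (B : set (product_variety V W))).
  + exact: closed_preimage (morphism_snd V W).1 cA.
  + exact: iB iW1.
  + exact: iB iW2.
Qed.

Let mulW_gen u W : K0_mulW u (K0_gen W) ~ K0_mulgenW W u.
Proof.
elim: u => [V||u ih|u ihu v ihv] /=.
- exact/K0_iso/productC.
- exact: K0_refl.
- exact: K0_opp_congr.
- exact: K0_add_congr.
Qed.

Let mulW0 u : K0_mulW u K0_zeroW ~ K0_zeroW.
Proof.
elim: u => [V||u ih|u ihu v ihv] /=; try exact: K0_refl.
- apply: K0_trans (K0_opp_congr ih) _.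
  by apply: K0_trans (K0_sym (K0_add0 _)) _; exact: K0_addN.
- by apply: K0_trans (K0_add_congr ihu ihv) _; exact: K0_add0.
Qed.

Let addWACA a b c d : K0_addW (K0_addW a b) (K0_addW c d) ~
  K0_addW (K0_addW a c) (K0_addW b d).
Proof.
have aux x y z : K0_addW x (K0_addW y z) ~ K0_addW y (K0_addW x z).
  apply: K0_trans (K0_addA _ _ _) _.
  apply: K0_trans (K0_add_congr (K0_addC _ _) (K0_refl _)) _.
  exact/K0_sym/K0_addA.
apply: K0_trans (K0_sym (K0_addA _ _ _)) _.
apply: K0_trans (K0_add_congr (K0_refl _) (aux _ _ _)) _.
exact: K0_addA.
Qed.

Let oppW_uniq u v : K0_addW u v ~ K0_zeroW -> v ~ K0_oppW u.
Proof.
move=> uv; apply: K0_trans (K0_sym (K0_add0 v)) _.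
apply: K0_trans (K0_add_congr (K0_sym (K0_addN u)) (K0_refl v)) _.
apply: K0_trans (K0_add_congr (K0_addC _ _) (K0_refl v)) _.
apply: K0_trans (K0_sym (K0_addA _ _ _)) _.
apply: K0_trans (K0_add_congr (K0_refl _) uv) _.
by apply: K0_trans (K0_addC _ _) _; exact: K0_add0.
Qed.

Let oppWD u v : K0_oppW (K0_addW u v) ~ K0_addW (K0_oppW u) (K0_oppW v).
Proof.
apply: K0_sym; apply: oppW_uniq.
apply: K0_trans (addWACA _ _ _ _) _.
apply: K0_trans (K0_add_congr (K0_addN u) (K0_addN v)) _.
exact: K0_add0.
Qed.

Let mulWD u v w : K0_mulW u (K0_addW v w) ~ K0_addW (K0_mulW u v) (K0_mulW u w).
Proof.
elim: u => [V||u ih|u ihu u' ihu'] /=.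
- exact: K0_refl.
- exact/K0_sym/K0_add0.
- by apply: K0_trans (K0_opp_congr ih) _; exact: oppWD.
- by apply: K0_trans (K0_add_congr ihu ihu') _; exact: addWACA.
Qed.

Let mulWN u v : K0_mulW u (K0_oppW v) ~ K0_oppW (K0_mulW u v).
Proof.
elim: u => [V||u ih|u ihu u' ihu'] /=.
- exact: K0_refl.
- by apply: K0_trans (K0_sym (K0_addN _)) _; exact: K0_add0.
- exact: K0_opp_congr.
- by apply: K0_trans (K0_add_congr ihu ihu') _; exact/K0_sym/oppWD.
Qed.

Let mulWC u v : K0_mulW u v ~ K0_mulW v u.
Proof.
elim: v => [V||v ih|v ih v' ih'] /=.
- exact: mulW_gen.
- exact: mulW0.
- by apply: K0_trans (mulWN _ _) _; exact: K0_opp_congr.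
- by apply: K0_trans (mulWD _ _ _) _; exact: K0_add_congr.
Qed.

Let mulW_congrr u v v' : v ~ v' -> K0_mulW u v ~ K0_mulW u v'.
Proof.
move=> vv'; elim: u => [V||u ih|u ihu u' ihu'] /=.
- exact: gen_congr.
- exact: K0_refl.
- exact: K0_opp_congr.
- exact: K0_add_congr.
Qed.

Let mulW_congr u u' v v' : u ~ u' -> v ~ v' -> K0_mulW u v ~ K0_mulW u' v'.
Proof.
move=> uu' vv'; apply: K0_trans (mulW_congrr _ vv') _.
apply: K0_trans (mulWC _ _) _; apply: K0_trans (mulW_congrr _ uu') _.
exact: mulWC.
Qed.

Let mulWA u v w : K0_mulW u (K0_mulW v w) ~ K0_mulW (K0_mulW u v) w.
Proof.
elim: u => [V||u ih|u ihu u' ihu'] /=.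
- elim: v => [V'||v ih|v ihv v' ihv'] /=.
  + elim: w => [V''||w ih|w ihw w' ihw'] /=.
    * exact/K0_iso/productA.
    * exact: K0_refl.
    * exact: K0_opp_congr.
    * exact: K0_add_congr.
  + exact: K0_refl.
  + exact: K0_opp_congr.
  + exact: K0_add_congr.
- exact: K0_refl.
- exact: K0_opp_congr.
- exact: K0_add_congr.
Qed.

Let mul1W u : K0_mulW (K0_gen (affine_variety k 0)) u ~ u.
Proof.
elim: u => [V||u ih|u ihu u' ihu'] /=.
- exact/K0_iso/product_affine_space0.
- exact: K0_refl.
- exact: K0_opp_congr.
- exact: K0_add_congr.
Qed.

Lemma K0_of_opp u : K0_opp (K0_of u) = K0_of (K0_oppW u).
Proof. exact/K0_ofP/K0_opp_congr/K0_repr_of. Qed.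

Lemma K0_of_add u v : K0_add (K0_of u) (K0_of v) = K0_of (K0_addW u v).
Proof. by apply/K0_ofP; apply: K0_add_congr; exact: K0_repr_of. Qed.

Lemma K0_of_mul u v : K0_mul (K0_of u) (K0_of v) = K0_of (K0_mulW u v).
Proof. by apply/K0_ofP; apply: mulW_congr; exact: K0_repr_of. Qed.

Lemma K0_ring_theory :
  Ring_theory.ring_theory K0_zero K0_one K0_add K0_mul K0_sub K0_opp eq.
Proof.
have ofW (P : K0 -> Prop) : (forall u, P (K0_of u)) -> forall a, P a.
  by move=> Pu a; rewrite -(K0_reprK a).
split; do ?[elim/ofW=> ?]; rewrite /K0_sub ?(K0_of_opp, K0_of_add, K0_of_mul) //;
  apply/K0_ofP.
- exact: K0_add0.
- exact: K0_addC.
- exact: K0_addA.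
- exact: mul1W.
- exact: mulWC.
- exact: mulWA.
- exact: K0_addN.
Qed.

Lemma K0_class_iso (V V' : variety k) :
  isomorphic V V' -> K0_class V = K0_class V'.
Proof. by move=> VV'; exact/K0_ofP/K0_iso. Qed.

Lemma K0_class_scissor (V V1 V2 : variety k) (W : set V) : closed W ->
    isomorphic V1 (restriction (~` W)) -> isomorphic V2 (restriction W) ->
  K0_class V = K0_add (K0_class V1) (K0_class V2).
Proof.
by move=> cW iV1 iV2; rewrite K0_of_add; exact/K0_ofP/(K0_scissor cW iV1 iV2).
Qed.

Lemma K0_class_product (V W : variety k) :
  K0_class (product_variety V W) = K0_mul (K0_class V) (K0_class W).
Proof. by rewrite K0_of_mul. Qed.

End GrothendieckRing.

Section Jets.
Variable k : closedFieldType.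

Definition is_ideal d (J : set {mpoly k[d]}) :=
  [/\ J 0, forall p q, J p -> J q -> J (p + q) & forall p q, J q -> J (p * q)].

Definition ideal_gen d (S : set {mpoly k[d]}) : set {mpoly k[d]} :=
  [set p | forall J, is_ideal J -> S `<=` J -> J p].

Lemma ideal_genP d (S : set {mpoly k[d]}) : is_ideal (ideal_gen S).
Proof.
split=> [J []|p q Sp Sq J|p q Sq J] //.
- by move=> iJ SJ; have [_ + _] := iJ; apply; [exact: Sp | exact: Sq].
- by move=> iJ SJ; have [_ _] := iJ; apply; exact: Sq.
Qed.

(* A closed subscheme of affine d-space. *)
Record subscheme d := Subscheme {
  ideal :> set {mpoly k[d]};
  idealP : is_ideal ideal
}.

(* [zeros phi Y] is Y(A) = Hom(Spec A, Y) for the k-algebra phi : k -> A. *)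
Definition zeros d (A : comNzRingType) (phi : {rmorphism k -> A})
    (Y : subscheme d) : set ('I_d -> A) :=
  [set x | forall p, ideal Y p -> mmap phi x p = 0].

Definition reduced_pts d (Y : subscheme d) : set (affine_space k d) :=
  [set x | zeros idfun Y ((x : 'rV[k]_d) 0)].

Lemma closed_reduced_pts d (Y : subscheme d) : closed (reduced_pts Y).
Proof. exact: closed_zeros. Qed.

(* Y with its reduced structure. *)
Definition reduced d (Y : subscheme d) : variety k :=
  Variety (is_affine_variety (@closed_reduced_pts d Y)).

Section Jet_scheme.
Variables (d n : nat).

(* The coordinate of index [mxvec_index i j] on affine d * n.+1-space is the
   coefficient of t ^ j in the i-th component of an n-jet. *)
Definition jet (A : comNzRingType) (x : 'I_(d * n.+1) -> A) (i : 'I_d) :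
  {poly A} := \sum_(j < n.+1) (x (mxvec_index i j))%:P * 'X^j.

Definition jet_eqs (X : subscheme d) : set {mpoly k[d * n.+1]} :=
  [set q | exists2 p, ideal X p & exists2 l, (l <= n)%N &
    q = (mmap (polyC \o @mpolyC _ k) (jet (fun i => 'X_i)) p)`_l].

Definition jet_scheme (X : subscheme d) : subscheme (d * n.+1) :=
  Subscheme (ideal_genP (jet_eqs X)).

Definition jet_ring (A : comNzRingType) := {poly %/ ('X^(n.+1) : {poly A})}.

Definition jet_point (A : comNzRingType) (x : 'I_(d * n.+1) -> A) (i : 'I_d) :
  jet_ring A := in_qpoly 'X^(n.+1) (jet x i).

End Jet_scheme.

Let mmap_morph d (R S : comNzRingType) (theta : {rmorphism R -> S})
    (f : k -> R) (h : 'I_d -> R) p :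
  theta (mmap f h p) = mmap (theta \o f) (theta \o h) p.
Proof.
rewrite /mmap rmorph_sum; apply: eq_bigr => m _.
rewrite rmorphM rmorph_prod; congr (_ * _).
by apply: eq_bigr => i _; rewrite rmorphXn.
Qed.

Let in_qpoly_eq0 n (A : comNzRingType) (q : {poly A}) :
  in_qpoly 'X^(n.+1) q = 0 <-> forall l, (l <= n)%N -> q`_l = 0.
Proof.
have val_in : (in_qpoly 'X^(n.+1) q : {poly A}) = take_poly n.+1 q.
  by rewrite /= mk_monic_Xn Pdiv.RingMonic.take_poly_rmodp.
split=> [q0 l ln|q0].
  move: (coef_take_poly n.+1 q l); rewrite -val_in q0 ltnS ln => <-.
  by rewrite coef0.
apply/val_inj; rewrite [LHS]val_in; apply/polyP => l.
by rewrite coef_take_poly coef0; case: ifP => // /q0.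
Qed.

(* Functor of points of the jet scheme: for every k-algebra A, [jet_point]
   identifies L_n(X)(A) with X(A[t]/(t ^ n.+1)). *)
Lemma jet_schemeP d n (X : subscheme d) (A : comNzRingType)
    (phi : {rmorphism k -> A}) :
  set_bij (zeros phi (jet_scheme n X))
    (zeros (@qpolyC A 'X^(n.+1) \o phi) X) (@jet_point d n A).
Proof.
pose ev (x : 'I_(d * n.+1) -> A) : {rmorphism {mpoly k[d * n.+1]} -> A} :=
  mmap phi x.
have jetE x : map_poly (ev x) \o jet (fun i => 'X_i) =1 jet x.
  move=> i; rewrite /= /jet rmorph_sum; apply: eq_bigr => j _.
  by rewrite rmorphM /= map_polyC /= map_polyXn mmapX mmap1U.
have evE x p : map_poly (ev x)
    (mmap (polyC \o @mpolyC _ k) (jet (fun i => 'X_i)) p) =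
    mmap (polyC \o phi) (jet x) p.
  rewrite mmap_morph; apply: eq_bigr => m _; congr (_ * _).
    by rewrite /= map_polyC /= mmapC.
  exact/mmap1_eq/jetE.
have inE x p : in_qpoly 'X^(n.+1) (mmap (polyC \o phi) (jet x) p) =
    mmap (@qpolyC A 'X^(n.+1) \o phi) (@jet_point d n A x) p.
  rewrite mmap_morph; apply: eq_bigr => m _; congr (_ * _).
  apply/val_inj => /=; rewrite Pdiv.CommonRing.rmodp_small // size_polyC.
  by apply: leq_ltn_trans (size_mk_monic_gt1 _); case: eqP.
have ptsE x : zeros phi (jet_scheme n X) x <->
    zeros (@qpolyC A 'X^(n.+1) \o phi) X (@jet_point d n A x).
  split=> [Jx p Xp|Xx q].
    rewrite -inE; apply/in_qpoly_eq0 => l ln.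
    rewrite -evE coef_map; apply: Jx => J iJ; apply.
    by exists p => //; exists l.
  move=> /(_ [set q | ev x q = 0]); apply.
    split=> [|p r /= p0 r0|p r /= r0] /=.
    - exact: rmorph0.
    - by rewrite rmorphD /= p0 r0 addr0.
    - by rewrite rmorphM /= r0 mulr0.
  move=> _ [p Xp [l ln ->]] /=; rewrite -coef_map evE.
  have /in_qpoly_eq0 p0 : in_qpoly 'X^(n.+1) (mmap (polyC \o phi) (jet x) p) = 0.
    by rewrite inE; exact: Xx.
  exact: p0.
have jet_small x i : (jet_point x i : {poly A}) = jet x i.
  rewrite in_qpoly_small // mk_monic_Xn size_polyXn ltnS /jet.
  apply: leq_trans (size_sum _ _ _) _; apply/bigmax_leqP => j _.
  by rewrite mul_polyC (leq_trans (size_scale_leq _ _)) // size_polyXn.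
have szq (q : jet_ring n A) : (size (q : {poly A}) <= n.+1)%N.
  have szX : size (mk_monic ('X^(n.+1) : {poly A})) = n.+2.
    by rewrite mk_monic_Xn size_polyXn.
  by rewrite -ltnS -[X in (_ < X)%N]szX; exact: size_mk_monic.
have jet_coef (x : 'I_(d * n.+1) -> A) i (j : 'I_n.+1) :
    (jet x i)`_j = x (mxvec_index i j).
  rewrite /jet coef_sum (bigD1 j) //= coefCM coefXn eqxx mulr1 big1 ?addr0 //.
  move=> j' /negPf jj'; rewrite coefCM coefXn (eq_sym (_ : nat)).
  by rewrite (inj_eq val_inj) jj' mulr0.
split=> [x /ptsE //|x y _ _ xy|y Xy].
- apply/funext => ij; case/mxvec_indexP: ij => i j.
  by rewrite -!jet_coef -!jet_small xy.
- pose x ij := (let: (i, j) := enum_val (cast_ord (esym (mxvec_cast d n.+1)) ij)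
    in (y i : {poly A})`_j).
  have xE i j : x (mxvec_index i j) = (y i : {poly A})`_j.
    by rewrite /x /mxvec_index cast_ordK enum_rankK.
  have xy : jet_point x = y.
    apply/funext => i; apply/val_inj; rewrite [LHS]jet_small; apply/polyP => l.
    have [ln|nl] := ltnP l n.+1.
      by rewrite (jet_coef _ _ (Ordinal ln)) xE.
    by rewrite !nth_default // (leq_trans _ nl) // -?jet_small szq.
  by exists x => //; apply/ptsE; rewrite xy.
Qed.

End Jets.

(* Main.v *)
From Stdlib Require Ring_theory.
From HB Require Import structures.
From mathcomp Require Import all_boot all_order all_algebra.
From mathcomp Require Import mpoly.
From mathcomp Require Import ring zify.
From mathcomp Require Import boolp classical_sets functions topology.
Require Import Defs.

(** An n-jet of affine N-space is a vector x of N power series modulo t^(n+1).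
    Let f be the vector of the m equations and D its Jacobian matrix.  Cut a jet
    at order r, as x = a + t^r b with a a polynomial of degree less than r.  Then
      f(x) = f(a) + t^r D(a) b + t^(2r) Q(a, b).
    If t^(r-1) kills the cokernel of D(a) over k[[t]], say D(a) B = t^(r-1), then
    t^(2r) Q = t^r D(a) (t B Q), and b' = b + t B Q(a, b) is a triangular change of
    variables, hence invertible ([solveP]), which makes the equation linear:
      f(a) + t^r D(a) b' = 0 modulo t^(n+1)                     ([peval_glue_eq0]).
    The same holds with B = 0 when 2r >= n+1.  So the jets of X over a given a form
    an affine space, or nothing; its direction is the kernel of D(a) modulo t^w,
    for w = n+1-r.

    Over a set of a on which Gaussian elimination for this linear system has
    regular coefficients, the fibration is trivial, and the class of its total
    space is a multiple of the power of L given by the dimension of the fibers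
    ([linear_fibration], [jets_fibration]).  Every matrix of regular functions has
    this property on the pieces of a finite cut ([cut_gauss]), and divisibility of
    the classes of the pieces gives that of the whole ([divisible_cut]).

    It remains to choose r.  Let e be the least exponent, possibly infinite, such
    that t^e kills the cokernel of D(x), a condition on x modulo t^(e+1).  Since
    t^(e-1) does not, the image of D modulo t^w has codimension at least e for
    every w >= e ([rank_jmx_lt]), so the fibers have dimension at least
    (N-m) w + e.
    - If 2e < n, take r = e+1, so that w = n-e.  The bound is good enough:
        2 ((N-m) (n-e) + e) - (N-m+1) n = (N-m-1) (n-2e) >= 0.
    - Otherwise let w be the integer part of (n+1)/2, so that r >= w, and use that
      t^(w-1) does not kill the cokernel: the dimension is at least
      (N-m) w + w >= (N-m+1) n/2.
    Both cases are in [divisible_stratum]. *)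

Set Implicit Arguments.
Unset Strict Implicit.
Unset Printing Implicit Defensive.

Import GRing.Theory.
Local Open Scope classical_set_scope.
Local Open Scope ring_scope.

(** * Regular functions and affine spaces *)

Section RegularFunctions.
Variable k : closedFieldType.
Implicit Types X Y Z : space k.

Definition rfun Z (F : Z -> k) := forall z, regular z F.

Lemma rfun_cst Z c : rfun (fun _ : Z => c).
Proof. by move=> z; exact: regular_cst. Qed.

Lemma rfunD Z (F G : Z -> k) : rfun F -> rfun G -> rfun (fun z => F z + G z).
Proof. by move=> rF rG z; exact: regularD. Qed.

Lemma rfunM Z (F G : Z -> k) : rfun F -> rfun G -> rfun (fun z => F z * G z).
Proof. by move=> rF rG z; exact: regularM. Qed.

Lemma rfunN Z (F : Z -> k) : rfun F -> rfun (fun z => - F z).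
Proof.
move=> rF; rewrite (_ : (fun z => _) = (fun z => -1 * F z)).
  exact: rfunM (rfun_cst _) rF.
by apply/funext => z; rewrite mulN1r.
Qed.

Lemma rfunB Z (F G : Z -> k) : rfun F -> rfun G -> rfun (fun z => F z - G z).
Proof. by move=> rF rG; exact/rfunD/rfunN. Qed.

Lemma rfunV Z (F : Z -> k) :
  rfun F -> (forall z, F z != 0) -> rfun (fun z => (F z)^-1).
Proof. by move=> rF F0 z; exact: regularV. Qed.

Lemma rfun_sum Z I (s : seq I) (P : pred I) (F : I -> Z -> k) :
  (forall i, rfun (F i)) -> rfun (fun z => \sum_(i <- s | P i) F i z).
Proof.
move=> rF; elim: s => [|i s ih].
  by under eq_fun do rewrite big_nil; exact: rfun_cst.
under eq_fun do rewrite big_cons.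
by case: (P i) => //; exact: rfunD.
Qed.

Lemma rfun_prod Z I (s : seq I) (P : pred I) (F : I -> Z -> k) :
  (forall i, rfun (F i)) -> rfun (fun z => \prod_(i <- s | P i) F i z).
Proof.
move=> rF; elim: s => [|i s ih].
  by under eq_fun do rewrite big_nil; exact: rfun_cst.
under eq_fun do rewrite big_cons.
by case: (P i) => //; exact: rfunM.
Qed.

Lemma closed_rfun_eq0 Z (F : Z -> k) : rfun F -> closed [set z | F z = 0].
Proof.
move=> rF; rewrite -openC openE => z /= /eqP Fz.
by apply: filterS (regular_neq0 (rF z) Fz) => y /eqP.
Qed.

Definition rmx Z p q (M : Z -> 'M[k]_(p, q)) := forall i j, rfun (fun z => M z i j).

Lemma rmx_cst Z p q (A : 'M[k]_(p, q)) : rmx (fun _ : Z => A).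
Proof. by move=> i j; exact: rfun_cst. Qed.

Lemma rmxD Z p q (M N : Z -> 'M[k]_(p, q)) :
  rmx M -> rmx N -> rmx (fun z => M z + N z).
Proof.
by move=> rM rN i j; under eq_fun do rewrite mxE; exact: rfunD.
Qed.

Lemma rmxN Z p q (M : Z -> 'M[k]_(p, q)) : rmx M -> rmx (fun z => - M z).
Proof. by move=> rM i j; under eq_fun do rewrite mxE; exact: rfunN. Qed.

Lemma rmxB Z p q (M N : Z -> 'M[k]_(p, q)) :
  rmx M -> rmx N -> rmx (fun z => M z - N z).
Proof. by move=> rM rN; exact/rmxD/rmxN. Qed.

Lemma rmxM Z p q r (M : Z -> 'M[k]_(p, q)) (N : Z -> 'M[k]_(q, r)) :
  rmx M -> rmx N -> rmx (fun z => M z *m N z).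
Proof.
move=> rM rN i j; under eq_fun do rewrite mxE.
by apply: rfun_sum => l; exact: rfunM.
Qed.

Lemma rmx_ext Z p q (M N : Z -> 'M[k]_(p, q)) : M =1 N -> rmx N -> rmx M.
Proof. by move=> /funext ->. Qed.

Lemma rmxZ Z p q (F : Z -> k) (M : Z -> 'M[k]_(p, q)) :
  rfun F -> rmx M -> rmx (fun z => F z *: M z).
Proof. by move=> rF rM i j; under eq_fun do rewrite mxE; exact: rfunM. Qed.

Lemma rmx_block Z p1 p2 q1 q2 (A : Z -> 'M[k]_(p1, q1)) (B : Z -> 'M[k]_(p1, q2))
    (C : Z -> 'M[k]_(p2, q1)) (D : Z -> 'M[k]_(p2, q2)) :
  rmx A -> rmx B -> rmx C -> rmx D ->
  rmx (fun z => block_mx (A z) (B z) (C z) (D z)).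
Proof.
move=> rA rB rC rD i j; case: (split_ordP i) => i' ->;
  case: (split_ordP j) => j' ->; under eq_fun do
    rewrite ?(block_mxEul, block_mxEur, block_mxEdl, block_mxEdr).
- exact: rA.
- exact: rB.
- exact: rC.
- exact: rD.
Qed.

Lemma rmx_xrow Z p q i1 i2 (M : Z -> 'M[k]_(p, q)) :
  rmx M -> rmx (fun z => xrow i1 i2 (M z)).
Proof. by move=> rM i j; under eq_fun do rewrite mxE; exact: rM. Qed.

Lemma rmx_xcol Z p q i1 i2 (M : Z -> 'M[k]_(p, q)) :
  rmx M -> rmx (fun z => xcol i1 i2 (M z)).
Proof. by move=> rM i j; under eq_fun do rewrite mxE; exact: rM. Qed.

Lemma rmx_submx Z p1 p2 q1 q2 (M : Z -> 'M[k]_(p1 + p2, q1 + q2)) : rmx M ->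
  [/\ rmx (fun z => ursubmx (M z)), rmx (fun z => dlsubmx (M z)) &
      rmx (fun z => drsubmx (M z))].
Proof.
by move=> rM; split=> i j; under eq_fun do rewrite !mxE; exact: rM.
Qed.

Lemma rfun_det Z p (M : Z -> 'M[k]_p) : rmx M -> rfun (fun z => \det (M z)).
Proof.
move=> rM; apply: rfun_sum => s; apply: rfunM; first exact: rfun_cst.
exact: rfun_prod.
Qed.

Lemma rmx_invmx Z p (M : Z -> 'M[k]_p) :
  rmx M -> (forall z, M z \in unitmx) -> rmx (fun z => invmx (M z)).
Proof.
move=> rM uM i j.
rewrite (_ : (fun z => _) = (fun z => (\det (M z))^-1 * cofactor (M z) j i)).
  apply: rfunM; first by apply: rfunV => [|z]; [exact: rfun_det|
    have := uM z; rewrite unitmxE unitfE].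
  rewrite /cofactor; apply: rfunM; first exact: rfun_cst.
  by apply: rfun_det => a b; under eq_fun do rewrite !mxE; exact: rM.
by apply/funext => z; rewrite /invmx (uM z) !mxE.
Qed.

Lemma closed_rmx_eq0 Z p q (M : Z -> 'M[k]_(p, q)) :
  rmx M -> closed [set z | M z = 0].
Proof.
move=> rM; rewrite -openC openE => z /= Mz.
have [i [j Mij]] : exists i j, M z i j != 0.
  apply/not_existsP => M0; apply: Mz; apply/matrixP => i j; rewrite mxE.
  by apply/eqP/negPn/negP => Mij; apply: (M0 i); exists j.
apply: filterS (regular_neq0 (rM i j z) Mij) => y My Myz.
by move: My; rewrite Myz mxE eqxx.
Qed.

Lemma morphism_rmx Z d (F : Z -> affine_space k d) :
  morphism F <-> rmx (F : Z -> 'rV[k]_d).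
Proof.
split=> [mF i j z|rF].
  have := regular_coord mF z j; apply: regular_eq.
  by apply: near_all => y; rewrite ord1.
by apply: morphism_to_affine => z i; exact: rF.
Qed.

Lemma rfun_comp Y Z (g : Z -> Y) (F : Y -> k) :
  morphism g -> rfun F -> rfun (F \o g).
Proof. by move=> [_ rg] rF z; exact/rg/rF. Qed.

Lemma morphism_lift Y Z (A : set Y) (g : Z -> Y) : morphism g ->
  (forall z, A (g z)) -> exists2 h : Z -> restriction A, morphism h & val \o h = g.
Proof.
move=> mg Ag; have Ag' z : g z \in A by rewrite inE.
exists (fun z => SigSub (Ag' z)); last by apply/funext.
exact: morphism_to_restriction.
Qed.

(** Isomorphisms between subsets are given by morphisms to the ambient spaces,
    which avoids membership proofs in the formulas that define them. *)
Lemma isomorphic_sub X Y (A : set X) (B : set Y)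
    (f : restriction A -> Y) (g : restriction B -> X) :
    morphism f -> morphism g ->
    (forall a, B (f a)) -> (forall b, A (g b)) ->
    (forall (a : restriction A) b, val b = f a -> g b = val a) ->
    (forall (b : restriction B) a, val a = g b -> f a = val b) ->
  isomorphic (restriction A) (restriction B).
Proof.
move=> mf mg Bf Ag fK gK.
have [f' mf' f'E] := morphism_lift mf Bf.
have [g' mg' g'E] := morphism_lift mg Ag.
exists f', g'; split=> // [a|b]; apply/val_inj.
  by move: (congr1 (@^~ (f' a)) g'E) => /= ->; apply: fK; rewrite -f'E.
by move: (congr1 (@^~ (g' b)) f'E) => /= ->; apply: gK; rewrite -g'E.
Qed.

Lemma restriction_restriction X (A B : set X) (W : set (restriction A)) :
  (forall a, W a <-> B (val a)) ->
  isomorphic (restriction W) (restriction (A `&` B)).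
Proof.
move=> WB.
have mval : morphism (fun w : restriction W => val (val w) : X).
  exact: morphism_comp (morphism_val W) (morphism_val A).
have [i mi iE] : exists2 i : restriction (A `&` B) -> restriction A,
    morphism i & val \o i = val.
  apply: morphism_lift; first exact: morphism_val.
  by move=> a; have [] := set_valP a.
apply: (isomorphic_sub mval mi) => [w|b|w b wb|b w wb].
- by split; [exact: set_valP | exact/WB/set_valP].
- by apply/WB; move: (congr1 (@^~ b) iE) => /= ->; have [] := set_valP b.
- by apply: val_inj; move: (congr1 (@^~ b) iE) => /= ->.
- by rewrite wb; move: (congr1 (@^~ b) iE).
Qed.

Lemma is_affine_variety_space Z : is_affine Z -> is_variety Z.
Proof.
move=> aZ; have [d [C [cC [f [g [mf mg fK gK]]]]]] := aZ; split.
  apply: (@separated_inj _ _ _ (val \o f)).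
  - exact: morphism_comp mf (morphism_val C).
  - by move=> x y /= /val_inj; exact: can_inj fK x y.
  - exact: separated_affine_space.
exists unit, (fun=> setT); split.
- by move=> _; exact: openT.
- by apply/seteqP; split=> // x _; exists tt.
- by move=> _; apply: is_affine_iso aZ; exact: restrictionT.
Qed.

(** A closed subset of a closed subset of affine space is the trace of a closed
    subset of affine space. *)
Lemma is_affine_closed Z (W : set Z) :
  is_affine Z -> closed W -> is_affine (restriction W).
Proof.
move=> [d [C [cC [f [g [mf mg fK gK]]]]]] cW.
have cgW : closed (g @^-1` W) by exact: closed_preimage mg.1 cW.
have [D cD DE] : exists2 D : set (affine_space k d), closed D &
    forall c : restriction C, D (val c) <-> W (g c).
  move: cgW; rewrite -openC => -[O oO OE].
  exists (~` O); first exact: open_closedC.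
  move=> c; have := congr1 (@^~ c) OE => /= E; rewrite /setC /= in E *.
  by rewrite E; split=> [/contrapT|?].
exists d, (C `&` D); split; first exact: closedI.
apply: isomorphic_trans (restriction_restriction (W := g @^-1` W) _).
  by apply: (isomorphic_restriction mf mg fK gK) => x /=; rewrite fK.
by move=> c; rewrite DE.
Qed.

Lemma is_affine_affine_space d : is_affine (affine_space k d).
Proof.
exists d, setT; split; first exact: closedT.
exact/isomorphic_sym/restrictionT.
Qed.

(** The locus F <> 0 is isomorphic to the closed subset F y = 1 of the product of
    Z with the line, by the graph of 1 / F. *)
Lemma is_affine_neq0 Z (F : Z -> k) :
  is_affine Z -> rfun F -> is_affine (restriction [set z | F z <> 0]).
Proof.
move=> aZ rF; pose P := product Z (affine_space k 1).
pose y (w : P) : k := (w.2 : 'rV[k]_1) 0 0.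
have ry : rfun y by move=> w; exact: regular_coord (morphism_snd _ _) w 0.
have rG : rfun (fun w : P => F w.1 * y w - 1).
  apply: rfunB (rfun_cst _); apply: rfunM ry.
  exact: rfun_comp (morphism_fst _ _) rF.
have aP : is_affine P by exact: is_affine_product (is_affine_affine_space 1).
apply: is_affine_iso (is_affine_closed aP (closed_rfun_eq0 rG)).
pose D := [set z | F z <> 0].
have rFv : rfun (fun a : restriction D => F (val a)).
  exact: rfun_comp (morphism_val D) rF.
apply: (@isomorphic_sub _ _ _ _
  (fun a : restriction D => (val a, const_mx (F (val a))^-1) : P)
  (fun b => (val b).1)).
- apply: morphism_to_product; first exact: morphism_val.
  apply/morphism_rmx => i j; under eq_fun do rewrite mxE.
  by apply: rfunV => // a; apply/eqP; exact: (set_valP a).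
- exact: morphism_comp (morphism_val _) (morphism_fst _ _).
- move=> a /=; rewrite /y /= mxE mulfV ?subrr //.
  by apply/eqP; exact: (set_valP a).
- move=> b /= Fb; have /eqP := set_valP b.
  by rewrite /= Fb mul0r sub0r oppr_eq0 oner_eq0.
- by move=> a b ->.
- move=> b a ab; rewrite ab.
  have Fb : F (val b).1 != 0 by apply/eqP; rewrite -ab; exact: (set_valP a).
  have : F (val b).1 * y (val b) - 1 = 0 := set_valP b.
  move/eqP; rewrite subr_eq0 => /eqP; rewrite /y.
  case: (\val b) Fb => z v /= Fz Fzv; congr (_, _).
  by apply/rowP => i; rewrite ord1 mxE -[LHS]mulr1 -Fzv mulKf.
Qed.

End RegularFunctions.

(** * Divisibility by a power of the class of the line *)

Section Divisibility.
Variable k : closedFieldType.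
Implicit Types X Y Z : space k.

Definition divisible (e : nat) Z := exists (vZ : is_variety Z) (a : K0 k),
  K0_class (Variety vZ) = K0_mul a (K0_exp (lefschetz k) e).

Let K0T := K0_ring_theory k.

Lemma K0_exp_add e e' :
  K0_exp (lefschetz k) (e + e') =
  K0_mul (K0_exp (lefschetz k) e) (K0_exp (lefschetz k) e').
Proof.
rewrite /K0_exp iterD; elim: e => [|e ih] /=.
  by rewrite (Ring_theory.Rmul_1_l K0T).
by rewrite ih (Ring_theory.Rmul_assoc K0T).
Qed.

Lemma K0_class_affine d :
  K0_class (affine_variety k d) = K0_exp (lefschetz k) d.
Proof.
elim: d => [//|d ih]; rewrite /K0_exp iterS -/(K0_exp _ d) -ih.
rewrite -K0_class_product; apply: K0_class_iso; apply: isomorphic_sym.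
exact: product_affine_space.
Qed.

Lemma divisible_leq e e' Z : (e <= e')%N -> divisible e' Z -> divisible e Z.
Proof.
move=> ee' [vZ [a aE]]; exists vZ.
exists (K0_mul a (K0_exp (lefschetz k) (e' - e))).
by rewrite aE -(Ring_theory.Rmul_assoc K0T) -K0_exp_add subnK.
Qed.

Lemma divisible_iso e Z Z' :
  isomorphic Z Z' -> is_affine Z' -> divisible e Z -> divisible e Z'.
Proof.
move=> ZZ' aZ' [vZ [a aE]]; exists (is_affine_variety_space aZ'), a.
by rewrite -aE; apply: K0_class_iso; exact: isomorphic_sym.
Qed.

Lemma divisible_product e Z : is_affine Z ->
  divisible e (product Z (affine_space k e)).
Proof.
move=> aZ; have vZ := is_affine_variety_space aZ.
exists (is_variety_product vZ (is_variety_affine_space k e)).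
exists (K0_class (Variety vZ)).
by rewrite -K0_class_affine -K0_class_product; exact/K0_class_iso/isomorphic_refl.
Qed.

(** The empty space is isomorphic to its product with any affine space. *)
Lemma divisible_empty e Z : is_affine Z -> (Z -> False) -> divisible e Z.
Proof.
move=> aZ Z0; pose P := product Z (affine_space k e).
apply: divisible_iso _ aZ (divisible_product e aZ).
exists (fst : P -> Z), (fun z => match Z0 z with end); split.
- exact: morphism_fst.
- by split=> z; case: (Z0 z).
- by case=> z; case: (Z0 z).
- by move=> z; case: (Z0 z).
Qed.

Lemma divisible_scissor e Z (W : set Z) : is_variety Z -> closed W ->
    divisible e (restriction W) -> divisible e (restriction (~` W)) ->
  divisible e Z.
Proof.
move=> vZ cW [vW [a aE]] [vU [b bE]]; exists vZ, (K0_add b a).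
rewrite (Ring_theory.Rdistr_l K0T) -aE -bE.
apply: (@K0_class_scissor k (Variety vZ) (Variety vU) (Variety vW) W cW);
  exact: isomorphic_refl.
Qed.

(** F is total, so that the functions used to cut a set need not be restricted
    again to its pieces; its values away from A are irrelevant. *)
Definition regular_on Y (A : set Y) (F : Y -> k) :=
  rfun (fun a : restriction A => F (val a)).

Lemma regular_on_comp Y Z (A : set Y) (F : Y -> k) (g : Z -> Y) :
  morphism g -> (forall z, A (g z)) -> regular_on A F -> rfun (F \o g).
Proof.
move=> mg Ag rF; have [h mh <-] := morphism_lift mg Ag.
exact: rfun_comp mh rF.
Qed.

Lemma regular_onS Y (A B : set Y) F :
  A `<=` B -> regular_on B F -> regular_on A F.
Proof.
move=> AB rF; have AB' (a : restriction A) : B (val a) by exact/AB/set_valP.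
exact: (regular_on_comp (morphism_val A) AB' rF).
Qed.

Definition mx_regular_on Y p q (A : set Y) (M : Y -> 'M[k]_(p, q)) :=
  rmx (fun a : restriction A => M (val a)).

Lemma mx_regular_onS Y p q (A B : set Y) (M : Y -> 'M[k]_(p, q)) :
  A `<=` B -> mx_regular_on B M -> mx_regular_on A M.
Proof.
by move=> AB rM i j; exact: (@regular_onS _ _ _ (fun y => M y i j) AB (rM i j)).
Qed.

Lemma mx_regular_on_comp Y Z p q (A : set Y) (M : Y -> 'M[k]_(p, q)) (g : Z -> Y) :
  morphism g -> (forall z, A (g z)) -> mx_regular_on A M -> rmx (M \o g).
Proof.
move=> mg Ag rM i j.
exact: (@regular_on_comp _ _ _ (fun y => M y i j) _ mg Ag (rM i j)).
Qed.

(** A tree whose nodes cut a set along the zeros of a regular function, and whose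
    leaves are pieces satisfying Q.  The functions are invariant under tau, which
    below is a truncation of jets: the pieces are then unions of fibers of tau. *)
Inductive cut Y (tau : Y -> Y) (Q : set Y -> Prop) : set Y -> Prop :=
| cut_leaf A : Q A -> cut tau Q A
| cut_node A F : regular_on A F -> (forall y, F (tau y) = F y) ->
    cut tau Q (A `&` [set y | F y = 0]) -> cut tau Q (A `&` [set y | F y <> 0]) ->
    cut tau Q A.

Lemma cut_bind Y tau (Q R : set Y -> Prop) A :
  cut tau Q A -> (forall B, Q B -> cut tau R B) -> cut tau R A.
Proof.
move=> cA QR; elim: cA => [|{}A F rF iF _ ih _ ih']; first exact: QR.
exact: cut_node iF ih ih'.
Qed.

Lemma cut_sub Y tau (Q : set Y -> Prop) A : cut tau Q A ->
  cut tau (fun B => Q B /\ B `<=` A) A.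
Proof.
elim=> [{}A QA|{}A F rF iF _ ih _ ih']; first by apply: cut_leaf; split.
apply: cut_node iF _ _ => //.
  by apply: cut_bind ih _ => B [QB BA]; apply: cut_leaf; split=> // y /BA[].
by apply: cut_bind ih' _ => B [QB BA]; apply: cut_leaf; split=> // y /BA[].
Qed.

Lemma cut_weaken Y tau (Q R : set Y -> Prop) A :
  (forall B, B `<=` A -> Q B -> R B) -> cut tau Q A -> cut tau R A.
Proof.
move=> QR /cut_sub cA; apply: cut_bind cA _ => B [QB BA].
by apply: cut_leaf; exact: QR.
Qed.

Definition invariant_set Y (tau : Y -> Y) (A : set Y) := forall y, A (tau y) <-> A y.

(** Each node of the tree is a scissor relation in K0.  Only closed subsets and
    nonvanishing loci of one function occur, so all pieces remain affine. *)
Lemma divisible_cut Y (E : set Y) tau e A :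
    is_affine (restriction A) -> invariant_set tau A ->
    is_affine (restriction (E `&` A)) ->
    cut tau (fun B => is_affine (restriction B) -> invariant_set tau B ->
      is_affine (restriction (E `&` B)) -> divisible e (restriction (E `&` B))) A ->
  divisible e (restriction (E `&` A)).
Proof.
move=> + + + cA; elim: cA => [//|{}A F rF iF _ ih0 _ ih1] aA iA aEA.
have rFE : regular_on (E `&` A) F by apply: regular_onS rF => y [].
pose W := [set a : restriction (E `&` A) | F (val a) = 0].
have cW : closed W by exact: closed_rfun_eq0.
have iW : isomorphic (restriction W)
    (restriction (E `&` (A `&` [set y | F y = 0]))).
  by rewrite setIA; exact: restriction_restriction.
have iU : isomorphic (restriction (~` W))
    (restriction (E `&` (A `&` [set y | F y <> 0]))).
  by rewrite setIA; exact: restriction_restriction.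
have aW : is_affine (restriction W) by exact: is_affine_closed.
have aU : is_affine (restriction (~` W)) by exact: is_affine_neq0.
apply: (divisible_scissor (is_affine_variety_space aEA) cW).
- apply: divisible_iso (isomorphic_sym iW) (aW) _; apply: ih0.
  + apply: is_affine_iso (is_affine_closed aA (closed_rfun_eq0 rF)).
    by apply: isomorphic_sym; exact: restriction_restriction.
  + by move=> y; rewrite /setI /= iF iA.
  + exact: is_affine_iso (isomorphic_sym iW) aW.
- apply: divisible_iso (isomorphic_sym iU) (aU) _; apply: ih1.
  + apply: is_affine_iso (is_affine_neq0 aA rF).
    by apply: isomorphic_sym; exact: restriction_restriction.
  + by move=> y; rewrite /setI /= iF iA.
  + exact: is_affine_iso (isomorphic_sym iU) aU.
Qed.

Lemma cut_family Y (tau : Y -> Y) (A : set Y) (I : finType) (F : I -> Y -> k) :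
    (forall i, regular_on A (F i)) -> (forall i y, F i (tau y) = F i y) ->
  cut tau (fun B => forall i,
     (forall y, B y -> F i y = 0) \/ (forall y, B y -> F i y <> 0)) A.
Proof.
move=> rF iF.
suff: cut tau (fun B => forall i, i \in enum I ->
    (forall y, B y -> F i y = 0) \/ (forall y, B y -> F i y <> 0)) A.
  by apply: cut_weaken => B _ FB i; apply: FB; rewrite mem_enum.
elim: (enum I) A rF => [|i s ih] A rF; first by apply: cut_leaf.
have ihA B : B `<=` A ->
    (forall y, B y -> F i y = 0) \/ (forall y, B y -> F i y <> 0) ->
    cut tau (fun B => forall j, j \in i :: s ->
     (forall y, B y -> F j y = 0) \/ (forall y, B y -> F j y <> 0)) B.
  move=> BA FB; apply: cut_weaken (ih B _) => [C CB sC j|j].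
    rewrite inE => /orP[/eqP->|/sC//].
    by case: FB => FB; [left|right] => y /CB/FB.
  exact: regular_onS BA (rF j).
apply: (cut_node (rF i) (iF i)); apply: ihA => [y []//|].
- by left=> y [].
- by right=> y [].
Qed.

End Divisibility.

(** * Linear systems depending on a point *)

Section Gauss.
Variable k : closedFieldType.
Implicit Types X Y Z : space k.

(** The two invertible matrices of the decomposition of M by Gaussian elimination
    are regular, and the rank is constant: kernels, cokernels and partial inverses
    of M are then regular too. *)
Definition gauss_on Y (B : set Y) p q (M : Y -> 'M[k]_(p, q)) r :=
  [/\ mx_regular_on B (fun y => col_ebase (M y)),
      mx_regular_on B (fun y => row_ebase (M y)) &
      forall y, B y -> \rank (M y) = r].

(** Gaussian elimination branches only on the choice of a nonzero pivot.  Once the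
    vanishing of each entry is constant on a piece, so is the position of the
    pivot, and one elimination step is regular there. *)
Lemma cut_gauss Y (tau : Y -> Y) (A : set Y) p q (M : Y -> 'M[k]_(p, q)) :
    mx_regular_on A M -> (forall y, M (tau y) = M y) ->
  cut tau (fun B => exists r, gauss_on B M r) A.
Proof.
pose GE p q (M : 'M[k]_(p, q)) := Gaussian_elimination_ M.
move=> rM iM; suff: cut tau (fun B => exists r,
    [/\ mx_regular_on B (fun y => (GE _ _ (M y)).1.1),
      mx_regular_on B (fun y => (GE _ _ (M y)).1.2) &
      forall y, B y -> (GE _ _ (M y)).2 = r]) A.
  apply: cut_weaken => B _ [r [rL rU rr]]; exists r; split.
  - by apply: rmx_ext rL => y; rewrite /col_ebase unlock.
  - by apply: rmx_ext rU => y; rewrite /row_ebase unlock.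
  - by move=> y By; rewrite mxrankE rr.
elim: p q M iM A rM => [|p ih] [|q] M iM A rM.
1,2,3: by apply: cut_leaf; exists 0%N; split=> //; exact: rmx_cst.
pose F (ij : 'I_p.+1 * 'I_q.+1) y := M y ij.1 ij.2.
apply: cut_bind (cut_sub (cut_family (F := F) (A := A) (tau := tau) _ _)) _.
- by move=> ij; exact: rM.
- by move=> ij y; rewrite /F iM.
move=> C [FC CA]; have {}rM := mx_regular_onS CA rM.
(* P ij does not depend on the point, so it determines the pivot on all of C. *)
pose P ij := `[< exists2 y, C y & F ij y <> 0 >].
have PE y : C y -> [pick ij | M y ij.1 ij.2 != 0] = [pick ij | P ij].
  move=> Cy; apply: eq_pick => ij; apply/idP/asboolP => [/eqP Fy|[z Cz Fz]].
    by exists y.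
  by case: (FC ij) => [/(_ z Cz)//|/(_ y Cy)/eqP].
case: pickP PE => [[i j] /asboolP[z Cz Fz] PE|_ PE]; last first.
  apply: cut_leaf; exists 0%N; split; last 1 first.
  - by move=> y /PE; rewrite /GE /= => ->.
  - apply: rmx_ext (rmx_cst 1%:M) => y /=; have := PE _ (set_valP y).
    by rewrite /GE /= => ->.
  - apply: rmx_ext (rmx_cst 1%:M) => y /=; have := PE _ (set_valP y).
    by rewrite /GE /= => ->.
have Mij y : C y -> M y i j != 0.
  by move=> Cy; case: (FC (i, j)) => [/(_ z Cz)//|/(_ y Cy)/eqP].
pose A1 y : 'M_(1 + p, 1 + q) := xrow i 0 (xcol j 0 (M y)).
pose u y := ursubmx (A1 y); pose v y := (M y i j)^-1 *: dlsubmx (A1 y).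
pose N y := drsubmx (A1 y) - v y *m u y.
have rA1 : mx_regular_on C A1 by apply: rmx_xrow; exact: rmx_xcol.
have [ru rdl rdr] := rmx_submx rA1.
have rv : mx_regular_on C v.
  apply: rmxZ => //.
  by apply: rfunV => [|c]; [exact: rM | exact/Mij/set_valP].
have rN : mx_regular_on C N by apply: rmxB => //; exact: rmxM.
have iN y : N (tau y) = N y by rewrite /N /v /u /A1 iM.
have GEE y : C y -> GE _ _ (M y) =
    (xrow i 0 (block_mx 1%:M 0 (v y) (GE _ _ (N y)).1.1 : 'M_(1 + p)),
     xcol j 0 (block_mx (M y i j)%:M (u y) 0 (GE _ _ (N y)).1.2 : 'M_(1 + q)),
     (GE _ _ (N y)).2.+1).
  move=> Cy; rewrite {1}/GE /= PE // -/(GE _ _ (N y)).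
  by case: (GE _ _ (N y)) => [[L U] r].
apply: cut_weaken (ih _ _ iN _ rN) => B BC [r [rL rU rr]]; exists r.+1.
have GEB (y : restriction B) := GEE _ (BC _ (set_valP y)).
split; last by move=> y By; rewrite GEE ?rr //; exact: BC.
- apply: rmx_ext => [y|]; first by rewrite GEB.
  apply: rmx_xrow; apply: (@rmx_block _ _ 1 p 1 p) => //; do ?exact: rmx_cst.
  exact: mx_regular_onS BC rv.
- apply: rmx_ext => [y|]; first by rewrite GEB.
  apply: rmx_xcol; apply: (@rmx_block _ _ 1 q 1 q) => //; do ?exact: rmx_cst.
    move=> a b; under eq_fun do rewrite !mxE.
    case: (a == b); last exact: rfun_cst.
    exact: (@regular_onS _ _ _ _ (fun y => M y i j) BC (rM i j)).
  exact: mx_regular_onS BC ru.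
Qed.

(** Invertible changes of coordinates turn the matrix into a standard projection,
    and the fibers into sets of points with prescribed first r coordinates.
    Solvability, that is c *m cokermx M = 0, is a closed condition on the base. *)
Lemma linear_fibration Y (A : set Y) p q r e (M : Y -> 'M[k]_(q, p))
    (c : Y -> 'rV[k]_p) :
    is_affine (restriction A) -> gauss_on A M r -> mx_regular_on A c ->
    (r + e <= q)%N ->
  divisible e (restriction ([set z | A z.1 /\ (z.2 : 'rV[k]_q) *m M z.1 = c z.1]
    : set (product Y (affine_space k q)))).
Proof.
move=> aA [rL rU rr] rc req; have rq : (r <= q)%N := leq_trans (leq_addr _ _) req.
pose E : set (product Y (affine_space k q)) :=
  [set z | A z.1 /\ (z.2 : 'rV[k]_q) *m M z.1 = c z.1].
change (divisible e (restriction E)).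
suff [d dE [W [aW iW]]] : exists2 d, (e <= d)%N & exists W : set Y,
    is_affine (restriction W) /\ isomorphic (restriction E)
      (restriction ([set z | W z.1 /\ setT z.2] : set (product Y (affine_space k d)))).
  have iE : isomorphic (product (restriction W) (affine_space k d)) (restriction E).
    apply: isomorphic_trans (isomorphic_sym iW).
    apply: isomorphic_trans (product_restriction _ _).
    apply: isomorphic_product; first exact: isomorphic_refl.
    exact/isomorphic_sym/restrictionT.
  apply: (divisible_leq dE); apply: divisible_iso (iE) _ _.
    apply: is_affine_iso (isomorphic_sym iE) _.
    exact: is_affine_product (is_affine_affine_space _ _).
  exact: divisible_product.
pose d := (q - r)%N; exists d; first by rewrite leq_subRL.
have rcok : mx_regular_on A (fun y => c y *m cokermx (M y)).
  apply: rmxM => //; rewrite /cokermx.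
  apply: (rmx_ext (N := fun a : restriction A =>
    invmx (row_ebase (M (val a))) *m copid_mx r)).
    by move=> a; rewrite rr //; exact: set_valP.
  apply: rmxM (rmx_cst _); apply: rmx_invmx => // a; exact: row_ebase_unit.
pose W := A `&` [set y | c y *m cokermx (M y) = 0]; exists W; split.
  apply: is_affine_iso (is_affine_closed aA (closed_rmx_eq0 rcok)).
  by apply: isomorphic_sym; exact: restriction_restriction.
(* The inclusion of the last d coordinates, in the complement of pid_mx r. *)
pose J : 'M[k]_(d, q) := \matrix_(i, j) ((j == (r + i)%N :> nat)%:R).
have JP p' : J *m pid_mx r = 0 :> 'M_(d, p').
  apply/matrixP => i j; rewrite !mxE big1 // => l _; rewrite !mxE.
  case: eqP => [->|_]; last by rewrite mul0r.
  by case: eqP => [_|_]; rewrite ?ltnNge ?leq_addr /= ?mulr0.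
have PJ p' : pid_mx r *m J^T = 0 :> 'M_(p', d).
  by apply: trmx_inj; rewrite trmx_mul trmxK tr_pid_mx JP trmx0.
have JJ : J *m J^T = 1%:M.
  apply/matrixP => i j; rewrite !mxE.
  have ri : (r + i < q)%N by rewrite -ltn_subRL.
  rewrite (bigD1 (Ordinal ri)) //= !mxE eqxx mul1r big1 ?addr0 => [|l].
    by rewrite eqn_add2l.
  by rewrite -(inj_eq val_inj) /= => /negPf li; rewrite !mxE li mul0r.
have JtJ : J^T *m J = copid_mx r.
  apply/matrixP => i j; rewrite !mxE.
  have [ir|ri] := ltnP i r.
    rewrite big1 => [|l _]; last first.
      by rewrite !mxE (ltn_eqF (leq_trans ir (leq_addr _ _))) mul0r.
    by rewrite andbT -(inj_eq val_inj) subrr.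
  have id : (i - r < d)%N by rewrite ltn_sub2r // (leq_ltn_trans ri).
  rewrite (bigD1 (Ordinal id)) //= !mxE /= subnKC // eqxx mul1r big1 ?addr0.
    by rewrite andbF subr0 eq_sym.
  move=> l; rewrite -(inj_eq val_inj) /= => li; rewrite !mxE.
  case: ((i : nat) =P (r + l)%N) li => [->|_ _]; last by rewrite mul0r.
  by rewrite addKn eqxx.
pose PE := product Y (affine_space k q); pose PW := product Y (affine_space k d).
pose SW : set PW := [set z | W z.1 /\ setT z.2].
have m1 (Q : space k) (S : set (product Y Q)) :
    morphism (fun a : restriction S => (val a).1).
  exact: morphism_comp (morphism_val _) (morphism_fst _ _).
have m2 (d' : nat) (S : set (product Y (affine_space k d'))) :
    rmx (fun a : restriction S => (val a).2 : 'rV_d').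
  by apply/morphism_rmx; exact: morphism_comp (morphism_val _) (morphism_snd _ _).
apply: (@isomorphic_sub _ PE PW _ _
  (fun a => ((val a).1, ((val a).2 : 'rV_q) *m col_ebase (M (val a).1) *m J^T))
  (fun b => ((val b).1, c (val b).1 *m pinvmx (M (val b).1) +
     ((val b).2 : 'rV_d) *m J *m invmx (col_ebase (M (val b).1))))).
- apply: morphism_to_product; first exact: m1.
  apply/morphism_rmx; apply: rmxM (rmx_cst _); apply: rmxM (m2 _ _) _.
  apply: (mx_regular_on_comp (m1 _ _) _ rL) => a.
  by have [] := set_valP a.
- apply: morphism_to_product; first exact: m1.
  have Ab (b : restriction SW) : A (val b).1.
    by have [[]] := set_valP b.
  have rLb := mx_regular_on_comp (m1 _ _) Ab rL.
  have rUb := mx_regular_on_comp (m1 _ _) Ab rU.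
  have rLV : rmx (fun b : restriction SW =>
      invmx (col_ebase (M (val b).1))).
    by apply: rmx_invmx => // b; exact: col_ebase_unit.
  apply/morphism_rmx; apply: rmxD.
    apply: rmxM; first exact: (mx_regular_on_comp (m1 _ _) Ab rc).
    rewrite /pinvmx; apply: rmxM => //.
    apply: (rmx_ext (N := fun b : restriction SW =>
      invmx (row_ebase (M (val b).1)) *m pid_mx r)).
      by move=> b; rewrite rr.
    apply: rmxM (rmx_cst _); apply: rmx_invmx => // b; exact: row_ebase_unit.
  apply: rmxM => //; apply: rmxM (rmx_cst _); exact: m2.
- move=> a; have [Aa Ea] := set_valP a; split=> //; split=> //=.
  by rewrite -Ea -mulmxA mulmx_coker mulmx0.
- move=> b; have [[Ab /eqP cb] _] := set_valP b; split=> //=.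
  rewrite mulmxDl mulmxKpV ?submxE // -{2}(mulmx_ebase (M _)) !mulmxA.
  by rewrite mulmxKV ?col_ebase_unit // rr // -(mulmxA _ J) JP mulmx0 mul0mx addr0.
- move=> a b ba; have [Aa Ea] := set_valP a; rewrite ba.
  case: (\val a) Aa Ea => y v /= Ay Ev; congr (_, _).
  rewrite -Ev -!mulmxA (mulmxA J^T) JtJ /pinvmx rr //.
  rewrite -{1}(mulmx_ebase (M y)) rr // -!mulmxA.
  rewrite (mulmxA (row_ebase _)) mulmxV ?row_ebase_unit // mul1mx.
  have rp : (r <= p)%N by rewrite -(rr y Ay) rank_leq_col.
  rewrite (mulmxA (pid_mx r)) pid_mx_id // -!mulmxDr -mulmxDl addrC subrK.
  by rewrite mul1mx mulmxV ?col_ebase_unit // mulmx1.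
- move=> b a ab; have [[Ab _] _] := set_valP b; rewrite ab.
  case: (\val b) Ab => y v /= Ay; congr (_, _).
  rewrite mulmxDl mulmxKV ?col_ebase_unit // /pinvmx rr //.
  rewrite mulmxA mulmxKV ?col_ebase_unit // mulmxDl.
  by rewrite -(mulmxA v) JJ mulmx1 mulmxA -(mulmxA _ (pid_mx r)) PJ mulmx0 add0r.
Qed.

End Gauss.

(** * Taylor expansion of a polynomial to first order *)

Section Taylor.
Variables (k : fieldType) (N : nat).
Implicit Types (f g : {mpoly k[N]}) (x y a : 'I_N -> {poly k}).

(** Polynomials are generated, as an algebra, by constants and variables. *)
Lemma mpoly_alg_ind (P : {mpoly k[N]} -> Prop) :
    (forall c, P c%:MP) -> (forall i, P 'X_i) ->
    (forall f g, P f -> P g -> P (f + g)) -> (forall f g, P f -> P g -> P (f * g)) ->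
  forall f, P f.
Proof.
move=> PC PX PD PM; elim/mpolyind => [|c m f _ _ Pf]; first by rewrite -mpolyC0.
apply: PD => //; rewrite -mul_mpolyC; apply: (PM) => //; rewrite mpolyXE_id.
apply: (big_ind P) => [|f' g|i _]; [by rewrite -mpolyC1 | exact: PM | ].
elim: (m i) => [|e ih]; first by rewrite expr0 -mpolyC1.
by rewrite exprS; exact: PM.
Qed.

Definition peval x : {rmorphism {mpoly k[N]} -> {poly k}} := mmap polyC x.
Arguments peval : simpl never.

Lemma pevalC x c : peval x c%:MP = c%:P.
Proof. exact: mmapC. Qed.

Lemma pevalX x i : peval x 'X_i = x i.
Proof. by rewrite /peval /= mmapX mmap1U. Qed.

Lemma peval_congr d x y f :
  (forall i, d %| x i - y i) -> d %| peval x f - peval y f.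
Proof.
move=> dxy; elim/mpoly_alg_ind: f => [c|i|f g df dg|f g df dg].
- by rewrite !pevalC subrr dvdp0.
- by rewrite !pevalX.
- by rewrite !rmorphD opprD addrACA dvdp_add.
- rewrite !rmorphM /= (_ : _ - _ = (peval x f - peval y f) * peval x g +
    peval y f * (peval x g - peval y g)).
    by apply: dvdp_add; [exact: dvdp_mulr | exact: dvdp_mull].
  by rewrite mulrBl mulrBr addrA subrK.
Qed.

Lemma mderivXU i j : ('X_i)^`M(j) = (i == j)%:R :> {mpoly k[N]}.
Proof.
rewrite mderivX mnm1E; case: eqP => [->|_]; last by rewrite scale0r.
rewrite (_ : (_ - _)%MM = 0%MM) ?mpolyX0 ?scale1r //.
by apply/mnmP => l; rewrite mnmBE subnn mnm0E.
Qed.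

(** Two points x and y congruent to a modulo t have differences of values computed
    by the differential at a, up to t times the order of x - y.  With y = a this is
    Taylor's formula; with both x and y near a, it says that the remainder of that
    formula is contracting.  The proof is Leibniz' rule. *)
Lemma taylor t s x y a f :
    (forall i, t %| x i - a i) -> (forall i, t %| y i - a i) ->
    (forall i, t * s %| x i - y i) ->
  t * (t * s) %| peval x f - peval y f - \sum_i peval a f^`M(i) * (x i - y i).
Proof.
move=> tx ty txy.
pose D f := \sum_i peval a f^`M(i) * (x i - y i).
have tD f' : t * s %| D f'.
  by apply: (big_ind (fun p => t * s %| p)) => // [p q|i _];
    [exact: dvdp_add | exact: dvdp_mull].
rewrite -/(D f); elim/mpoly_alg_ind: f => [c|i|f g df dg|f g df dg].
- rewrite !pevalC subrr sub0r dvdpNr /D big1 ?dvdp0 // => i _.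
  by rewrite mderivC rmorph0 mul0r.
- rewrite !pevalX /D (bigD1 i) //= big1 => [|j /negPf ji].
    by rewrite mderivXU eqxx rmorph1 mul1r addr0 subrr dvdp0.
  by rewrite mderivXU eq_sym ji rmorph0 mul0r.
- rewrite !rmorphD (_ : D (f + g) = D f + D g).
    rewrite (_ : _ - _ = (peval x f - peval y f - D f) +
      (peval x g - peval y g - D g)); [exact: dvdp_add | ring].
  by rewrite /D -big_split /=; apply: eq_bigr => i _; rewrite mderivD rmorphD mulrDl.
- have DE : D (f * g) = D f * peval a g + peval a f * D g.
    rewrite /D mulr_suml mulr_sumr -big_split /=; apply: eq_bigr => i _.
    by rewrite mderivM rmorphD !rmorphM mulrDl mulrAC mulrA.
  rewrite DE !rmorphM.
  rewrite (_ : _ - _ = peval x f * (peval x g - peval y g - D g)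
    + (peval x f - peval a f) * D g + peval y g * (peval x f - peval y f - D f)
    + (peval y g - peval a g) * D f); last by ring.
  apply: dvdp_add; first apply: dvdp_add; first apply: dvdp_add.
  + exact: dvdp_mull.
  + by apply: dvdp_mul => //; exact: peval_congr.
  + exact: dvdp_mull.
  + by apply: dvdp_mul => //; exact: peval_congr.
Qed.

End Taylor.

(** * Truncated power series and linear maps between them *)

Section Truncated.
Variable k : fieldType.

Lemma dvdXnP w (p : {poly k}) : reflect (forall l, (l < w)%N -> p`_l = 0) ('X^w %| p).
Proof.
apply: (iffP (dvdpP _ _)) => [[q ->] l lw|p0]; first by rewrite coefMXn lw.
exists (drop_poly w p); rewrite -[LHS](poly_take_drop w).
rewrite (_ : take_poly w p = 0) ?add0r //; apply/polyP => l.
by rewrite coef_take_poly coef0; case: ifP => // /p0.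
Qed.

(** [jpoly] and [jvec] exchange a vector of N polynomials modulo t^w and the row of
    its coefficients, indexed as the coordinates of a jet scheme. *)
Definition jpoly N w (x : 'rV[k]_(N * w)) (i : 'I_N) : {poly k} :=
  rVpoly (row i (vec_mx x)).

Definition jvec N w (p : 'I_N -> {poly k}) : 'rV[k]_(N * w) :=
  mxvec (\matrix_(i, j) (p i)`_j).

Lemma jvecE N w p (i : 'I_N) (j : 'I_w) : jvec w p 0 (mxvec_index i j) = (p i)`_j.
Proof. by rewrite mxvecE mxE. Qed.

Lemma coef_jpoly N w x (i : 'I_N) (j : 'I_w) :
  (jpoly x i)`_j = x 0 (mxvec_index i j).
Proof. by rewrite coef_rVpoly_ord !mxE. Qed.

Lemma size_jpoly N w x (i : 'I_N) : (size (@jpoly N w x i) <= w)%N.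
Proof. exact: size_poly. Qed.

Lemma eq_jvec N w (p q : 'I_N -> {poly k}) :
  jvec w p = jvec w q <-> forall i, 'X^w %| p i - q i.
Proof.
split=> [pq i|pq].
  apply/dvdXnP => l lw; apply/eqP; rewrite coefB subr_eq0.
  by rewrite -(jvecE p i (Ordinal lw)) pq jvecE.
apply/rowP => a; case/mxvec_indexP: a => i j; rewrite !jvecE.
by apply/eqP; rewrite -subr_eq0 -coefB; apply/eqP/(dvdXnP _ _ (pq i)).
Qed.

Lemma jpolyK N w : cancel (@jpoly N w) (@jvec N w).
Proof.
move=> x; apply/rowP => a; case/mxvec_indexP: a => i j.
by rewrite jvecE coef_jpoly.
Qed.

Lemma jvecK N w (p : 'I_N -> {poly k}) i : 'X^w %| jpoly (jvec w p) i - p i.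
Proof. by apply/eq_jvec: i; rewrite jpolyK. Qed.

Lemma jvecP N w a (p q : 'I_N -> {poly k}) :
  jvec w (fun i => a *: p i + q i) = a *: jvec w p + jvec w q.
Proof.
by apply/rowP => l; case/mxvec_indexP: l => i j; rewrite !mxE !mxvecE !mxE coefD coefZ.
Qed.

Lemma jvec0 N w : jvec w (fun _ : 'I_N => 0) = 0.
Proof. by apply/rowP => l; case/mxvec_indexP: l => i j; rewrite jvecE coef0 mxE. Qed.

Lemma jpolyP N w a (x y : 'rV[k]_(N * w)) i :
  jpoly (a *: x + y) i = a *: jpoly x i + jpoly y i.
Proof. by rewrite /jpoly !linearP. Qed.

Lemma dvdp_sumr (I : finType) d (F : I -> {poly k}) :
  (forall i, d %| F i) -> d %| \sum_i F i.
Proof. move=> dF; apply: (big_ind (fun p => d %| p)) => [|p q|//]; first exact: dvdp0.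
exact: dvdp_add. Qed.

Section LinearMap.
Variables m N : nat.
Implicit Types D : 'I_m -> 'I_N -> {poly k}.

Definition act D (u : 'I_N -> {poly k}) i := \sum_j D i j * u j.

Lemma actP D a u v i :
  act D (fun j => a *: u j + v j) i = a *: act D u i + act D v i.
Proof.
rewrite /act scaler_sumr -big_split; apply: eq_bigr => j _ /=.
by rewrite mulrDr scalerAr.
Qed.

Lemma actB D a u v i : act D (fun j => u j - a * v j) i = act D u i - a * act D v i.
Proof.
rewrite /act mulr_sumr -sumrB; apply: eq_bigr => j _ /=.
by rewrite mulrBr mulrCA.
Qed.

Lemma act_congr d D D' u v i : (forall j, d %| D i j - D' i j) ->
  (forall j, d %| u j - v j) -> d %| act D u i - act D' v i.
Proof.
move=> dD du; rewrite /act -sumrB; apply: dvdp_sumr => j.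
rewrite (_ : _ - _ = (D i j - D' i j) * u j + D' i j * (u j - v j)); last by ring.
by apply: dvdp_add; [exact: dvdp_mulr | exact: dvdp_mull].
Qed.

Definition jact w D (b : 'rV[k]_(N * w)) := jvec w (act D (jpoly b)).

Fact jact_linear w D : linear (@jact w D).
Proof.
move=> a x y; rewrite /jact -jvecP; apply/eq_jvec => i; rewrite -actP.
by apply: act_congr => j; rewrite ?jpolyP subrr dvdp0.
Qed.
HB.instance Definition _ w D := GRing.isLinear.Build k _ _ _ (@jact w D) (@jact_linear w D).

Definition jmx w D : 'M[k]_(N * w, m * w) := lin1_mx (@jact w D).

Lemma mul_jmx w D b : b *m jmx w D = jvec w (act D (jpoly b)).
Proof. by rewrite mul_rV_lin1. Qed.

Lemma jvec_jmx w D u : jvec w u *m jmx w D = jvec w (act D u).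
Proof.
rewrite mul_jmx; apply/eq_jvec => i; apply: act_congr => j.
  by rewrite subrr dvdp0.
exact: jvecK.
Qed.

Lemma jmx_congr w D D' : (forall i j, 'X^w %| D i j - D' i j) -> jmx w D = jmx w D'.
Proof.
move=> DD; apply/row_matrixP => a; rewrite !rowE !mul_jmx; apply/eq_jvec => i.
by apply: act_congr => // j; rewrite subrr dvdp0.
Qed.

Lemma sub_jmx w D g : (jvec w g <= jmx w D)%MS <->
  exists u, forall i, 'X^w %| act D u i - g i.
Proof.
split=> [/submxP[b gE]|[u uP]].
  by exists (jpoly b); apply/eq_jvec; rewrite -mul_jmx gE.
by rewrite -(iffRL (eq_jvec _ _ _) uP) -jvec_jmx submxMl.
Qed.

Definition unitv e (i0 i : 'I_m) : {poly k} := if i == i0 then 'X^e else 0.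

(** The multiples of t^e lie in the image of D modulo t^(e+1).  By
    [kills_coker_lift] this is to say that t^e kills the cokernel of D over k[[t]],
    but it is a condition on D modulo t^(e+1). *)
Definition kills_coker D e :=
  [forall i0, (jvec e.+1 (unitv e i0) <= jmx e.+1 D)%MS].

(** Successive approximation: if t^e g = D u up to t^(e+w) h, then correcting u by
    t^w v, where D v = t^e h up to t^(e+1), leaves an error divisible by
    t^(e+w+1). *)
Lemma kills_coker_lift D e : kills_coker D e ->
  forall w i0, exists u, forall i, 'X^w %| act D u i - unitv e i0 i.
Proof.
move=> /forallP hD.
have hD' g : exists u, forall i, 'X^(e.+1) %| act D u i - 'X^e * g i.
  have /fin_all_exists[u uP] i0 := (sub_jmx _ _ _).1 (hD i0).
  exists (fun j => \sum_i0 g i0 * u i0 j) => i.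
  rewrite (_ : _ - _ = \sum_i0 g i0 * (act D (u i0) i - unitv e i0 i)).
    by apply: dvdp_sumr => i0; exact: dvdp_mull.
  under [RHS]eq_bigr do rewrite mulrBr; rewrite sumrB; congr (_ - _).
    under [RHS]eq_bigr do rewrite /act mulr_sumr; rewrite exchange_big /=.
    apply: eq_bigr => j _; rewrite mulr_sumr; apply: eq_bigr => i0 _.
    by rewrite mulrCA.
  rewrite (bigD1 i) //= big1 => [|i0 /negPf]; rewrite /unitv ?eqxx.
    by rewrite addr0 mulrC.
  by rewrite eq_sym => ->; rewrite mulr0.
move=> w i0.
suff [u uP] : exists u, forall i, 'X^(e + w) %| act D u i - unitv e i0 i.
  by exists u => i; apply: dvdp_trans (uP i); rewrite exprD dvdp_mull.
elim: w => [|w [u uP]].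
  exists (fun=> 0) => i; rewrite /act big1 => [|j _]; last by rewrite mulr0.
  by rewrite sub0r dvdpNr addn0 /unitv; case: ifP => _; rewrite ?dvdp0.
have /fin_all_exists[h hP] i := dvdpP _ _ (uP i).
have [v vP] := hD' h.
exists (fun j => u j - 'X^w * v j) => i; rewrite actB addrAC hP.
rewrite (_ : _ - _ = - 'X^w * (act D v i - 'X^e * h i)).
  by rewrite mulNr dvdpNr addnS -addSn addnC exprD dvdp_mul2l ?expf_neq0 ?polyX_eq0.
by rewrite exprD; ring.
Qed.

(** A linear form phi modulo t^(e+1) vanishes on the image of D and not at some
    t^e times a basis vector.  As the image is a k[t]-module, the forms phi(t^j g),
    for j <= e, vanish on it as well; their matrix on the vectors t^(e-l) times that
    basis vector is triangular, so they are independent. *)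
Lemma rank_jmx_lt D e w : ~~ kills_coker D e -> (e < w)%N ->
  (\rank (jmx w D) + e.+1 <= m * w)%N.
Proof.
move=> /forallPn[i0]; rewrite submxE => /eqP/rowP ne ew.
have [c nc] : exists c, (jvec e.+1 (unitv e i0) *m cokermx (jmx e.+1 D)) 0 c != 0.
  apply/existsP; apply: contra_notT ne => /existsPn n0 c; rewrite [RHS]mxE.
  exact/eqP/negPn/n0.
pose phi g := (jvec e.+1 g *m cokermx (jmx e.+1 D)) 0 c.
have phiE g h : (forall i, 'X^(e.+1) %| g i - h i) -> phi g = phi h.
  by move=> /eq_jvec gh; rewrite /phi gh.
have phiP a g h : phi (fun i => a *: g i + h i) = a * phi g + phi h.
  by rewrite /phi jvecP mulmxDl -scalemxAl mxE [X in X + _]mxE.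
have phi_act u : phi (act D u) = 0.
  by rewrite /phi -jvec_jmx -mulmxA mulmx_coker mulmx0 mxE.
pose Phi (b : 'rV[k]_(m * w)) : 'rV_e.+1 := \row_j phi (fun i => 'X^j * jpoly b i).
have Phi_linear : linear Phi.
  move=> a x y; apply/rowP => j; rewrite !mxE -phiP; apply: phiE => i.
  by rewrite jpolyP mulrDr scalerAr subrr dvdp0.
pose PhiL : {linear 'rV_(m * w) -> 'rV_e.+1} :=
  HB.pack Phi (GRing.isLinear.Build k _ _ _ Phi Phi_linear).
have PhiV p j : Phi (jvec w p) 0 j = phi (fun i => 'X^j * p i).
  rewrite mxE; apply: phiE => i; rewrite -mulrBr dvdp_mull //.
  by apply: dvdp_trans (jvecK w p i); rewrite -(subnK ew) exprD dvdp_mull.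
pose T : 'M_(e.+1, m * w) := \matrix_(l < e.+1) jvec w (unitv (e - l) i0).
have DPhi : jmx w D *m lin1_mx PhiL = 0.
  apply/row_matrixP => a; rewrite row_mul row0 mul_rV_lin1 rowE mul_jmx.
  apply/rowP => j; rewrite [LHS]PhiV mxE -(phi_act (fun l => 'X^j * jpoly (delta_mx 0 a) l)).
  apply: phiE => i; rewrite [X in _ - X](_ : _ = 'X^j * act D (jpoly (delta_mx 0 a)) i).
    by rewrite subrr dvdp0.
  by rewrite /act mulr_sumr; apply: eq_bigr => l _; rewrite mulrCA.
have TE l j : (T *m lin1_mx PhiL) l j = phi (unitv (j + (e - l)) i0).
  transitivity ((row l T *m lin1_mx PhiL) 0 j); first by rewrite -row_mul [RHS]mxE.
  rewrite mul_rV_lin1 rowK [LHS]PhiV; apply: phiE => i; rewrite /unitv.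
  by case: ifP => _; rewrite ?mulr0 -?exprD subrr dvdp0.
have Ttrig : is_trig_mx (T *m lin1_mx PhiL).
  apply/is_trig_mxP => l j lj; rewrite TE -(phi_act (fun=> 0)); apply: phiE => i.
  rewrite /act big1 ?subr0 => [|? _]; last by rewrite mulr0.
  rewrite /unitv; case: ifP => _; rewrite ?dvdp0 // dvdp_exp2l //.
  by have := ltn_ord l; lia.
have rT : \rank (lin1_mx PhiL) = e.+1.
  apply/eqP; rewrite eqn_leq rank_leq_col /=.
  apply: leq_trans (mxrankM_maxr T _); rewrite row_leq_rank row_free_unit.
  rewrite unitmxE unitfE det_trig //; apply/prodf_neq0 => l _.
  by rewrite TE subnKC // -ltnS.
by rewrite -rT; exact: mulmx0_rank_max.
Qed.
End LinearMap.
End Truncated.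
Arguments unitv {k m}.

(** * Contractions of truncated power series *)

Section Contraction.
Variables (k : fieldType) (N w : nat) (phi : 'rV[k]_(N * w) -> 'rV[k]_(N * w)).
Hypothesis phi_contr : forall l b b', (l < w)%N ->
  (forall j, 'X^l %| jpoly b j - jpoly b' j) ->
  forall j, 'X^(l.+1) %| jpoly (phi b) j - jpoly (phi b') j.

(** The inverse of b |-> b + phi b, as an iterated fixed point of b' - phi b: for a
    t-adic contraction, w steps determine a vector modulo t^w. *)
Definition solve b' := iter w (fun b => b' - phi b) 0.

(** After l steps, the iterates from any two starting points agree modulo t^l. *)
Let agree b' b1 b2 l : (l <= w)%N -> forall j,
  'X^l %| jpoly (iter l (fun b => b' - phi b) b1) j -
          jpoly (iter l (fun b => b' - phi b) b2) j.
Proof.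
elim: l => [|l ih] lw j; first by rewrite expr0 dvd1p.
have jB (x y : 'rV[k]_(N * w)) i : jpoly (x - y) i = jpoly x i - jpoly y i.
  by rewrite addrC -scaleN1r jpolyP scaleN1r addrC.
rewrite !iterS !jB opprB addrC addrA subrK.
by rewrite -dvdpNr opprB; apply: phi_contr => // i; exact/ih/ltnW.
Qed.

Let agreeE b' b1 b2 :
  iter w (fun b => b' - phi b) b1 = iter w (fun b => b' - phi b) b2.
Proof.
rewrite -[LHS]jpolyK -[RHS]jpolyK; apply/eq_jvec => i; exact: agree.
Qed.

Lemma solveK b : solve (b + phi b) = b.
Proof.
rewrite /solve (agreeE _ _ b).
have fixb l : iter l (fun b1 => b + phi b - phi b1) b = b.
  by elim: l => // l ih; rewrite iterS ih addrK.
exact: fixb.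
Qed.

Lemma solveP b' : solve b' + phi (solve b') = b'.
Proof.
have fixs : b' - phi (solve b') = solve b'.
  transitivity (iter w.+1 (fun b => b' - phi b) 0); first by [].
  by rewrite iterSr; exact: agreeE.
by rewrite -{1}fixs subrK.
Qed.
End Contraction.

(** * Regular families of polynomials *)
Section RegularPolynomials.
Variable k : closedFieldType.
Implicit Types Z : space k.

Definition rpoly Z (F : Z -> {poly k}) := forall l, rfun (fun z => (F z)`_l).

Lemma rpoly_ext Z (F G : Z -> {poly k}) : F =1 G -> rpoly G -> rpoly F.
Proof. by move=> /funext ->. Qed.

Lemma rpoly_cst Z p : rpoly (fun _ : Z => p).
Proof. by move=> l; exact: rfun_cst. Qed.

Lemma rpolyD Z (F G : Z -> {poly k}) :
  rpoly F -> rpoly G -> rpoly (fun z => F z + G z).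
Proof. by move=> rF rG l; under eq_fun do rewrite coefD; exact: rfunD. Qed.

Lemma rpolyB Z (F G : Z -> {poly k}) :
  rpoly F -> rpoly G -> rpoly (fun z => F z - G z).
Proof. by move=> rF rG l; under eq_fun do rewrite coefB; exact: rfunB. Qed.

Lemma rpolyM Z (F G : Z -> {poly k}) :
  rpoly F -> rpoly G -> rpoly (fun z => F z * G z).
Proof.
move=> rF rG l; under eq_fun do rewrite coefM.
by apply: rfun_sum => i; exact: rfunM.
Qed.

Lemma rpoly_sum Z (I : finType) (F : I -> Z -> {poly k}) :
  (forall i, rpoly (F i)) -> rpoly (fun z => \sum_i F i z).
Proof.
move=> rF l; under eq_fun do rewrite coef_sum.
by apply: rfun_sum => i; exact: rF.
Qed.

Lemma rpoly_take Z r (F : Z -> {poly k}) :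
  rpoly F -> rpoly (fun z => take_poly r (F z)).
Proof.
move=> rF l; under eq_fun do rewrite coef_take_poly.
by case: (l < r)%N; [exact: rF | exact: rfun_cst].
Qed.

Lemma rpoly_drop Z r (F : Z -> {poly k}) :
  rpoly F -> rpoly (fun z => drop_poly r (F z)).
Proof. by move=> rF l; under eq_fun do rewrite coef_drop_poly; exact: rF. Qed.

Lemma rpoly_peval Z N (x : Z -> 'I_N -> {poly k}) f :
  (forall i, rpoly (fun z => x z i)) -> rpoly (fun z => peval (x z) f).
Proof.
move=> rx; elim/mpoly_alg_ind: f => [c|i|f g rf rg|f g rf rg].
- by apply: rpoly_ext (rpoly_cst c%:P) => z; rewrite pevalC.
- by apply: rpoly_ext (rx i) => z; rewrite pevalX.
- by apply: rpoly_ext (rpolyD rf rg) => z; rewrite rmorphD.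
- by apply: rpoly_ext (rpolyM rf rg) => z; rewrite rmorphM.
Qed.

Lemma rpoly_jpoly Z N w (x : Z -> 'rV[k]_(N * w)) i :
  rmx x -> rpoly (fun z => jpoly (x z) i).
Proof.
move=> rx l; case: (ltnP l w) => lw.
  by under eq_fun do rewrite (coef_jpoly _ _ (Ordinal lw)); exact: rx.
under eq_fun do rewrite nth_default ?(leq_trans (size_jpoly _ _)) //.
exact: rfun_cst.
Qed.

Lemma rmx_jvec Z N w (p : Z -> 'I_N -> {poly k}) :
  (forall i, rpoly (fun z => p z i)) -> rmx (fun z => jvec w (p z)).
Proof.
move=> rp i0 j; rewrite ord1; case/mxvec_indexP: j => i j.
by under eq_fun do rewrite jvecE; exact: rp.
Qed.

Lemma rpoly_act Z m N (D : Z -> 'I_m -> 'I_N -> {poly k}) u i :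
  (forall i j, rpoly (fun z => D z i j)) -> (forall j, rpoly (fun z => u z j)) ->
  rpoly (fun z => act (D z) (u z) i).
Proof. by move=> rD ru; apply: rpoly_sum => j; exact: rpolyM. Qed.

Lemma rmx_jmx Z m N w (D : Z -> 'I_m -> 'I_N -> {poly k}) :
  (forall i j, rpoly (fun z => D z i j)) -> rmx (fun z => jmx w (D z)).
Proof.
move=> rD a c; under eq_fun do rewrite mxE.
apply: (rmx_jvec (p := fun z => act (D z) (jpoly (delta_mx 0 a)))) => i.
by apply: rpoly_act => // j; exact: rpoly_cst.
Qed.

End RegularPolynomials.

(** * First order expansion with its quadratic remainder *)

Section Remainder.
Variables (k : fieldType) (N m : nat) (f : 'I_m -> {mpoly k[N]}).
Implicit Types a b : 'I_N -> {poly k}.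

Definition jacobian a i j := peval a (f i)^`M(j).

Definition glue r a b j := a j + 'X^r * b j.

(** The quadratic term Q(a, b) in the expansion of f(a + t^r b). *)
Definition remainder r a b i := drop_poly (r + r)
  (peval (glue r a b) (f i) - peval a (f i) - 'X^r * act (jacobian a) b i).

Let act_taylor r a b b' i :
  \sum_j peval a (f i)^`M(j) * (glue r a b j - glue r a b' j) =
  'X^r * (act (jacobian a) b i - act (jacobian a) b' i).
Proof.
rewrite /act -sumrB mulr_sumr; apply: eq_bigr => j _.
by rewrite /jacobian /glue; ring.
Qed.

Lemma peval_glue r a b i : peval (glue r a b) (f i) =
  peval a (f i) + 'X^r * act (jacobian a) b i + 'X^(r + r) * remainder r a b i.
Proof.
have : 'X^(r + r) %| peval (glue r a b) (f i) - peval a (f i) -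
    'X^r * act (jacobian a) b i.
  have := @taylor _ _ 'X^r 1 (glue r a b) (glue r a (fun=> 0)) a (f i).
  rewrite mulr1 -exprD act_taylor.
  have g0 j : glue r a (fun=> 0) j = a j by rewrite /glue mulr0 addr0.
  have pg0 : peval (glue r a (fun=> 0)) (f i) = peval a (f i).
    apply/eqP; rewrite -subr_eq0 -dvd0p; apply: peval_congr => j.
    by rewrite g0 subrr.
  have act0 : act (jacobian a) (fun=> 0) i = 0.
    by rewrite /act big1 // => j _; rewrite mulr0.
  rewrite pg0 act0 subr0; apply=> j; rewrite ?g0 ?subrr ?dvdp0 //;
    by rewrite /glue addrC addKr dvdp_mulr.
move=> /dvdpP[q qE]; rewrite /remainder qE drop_polyMXn_id (mulrC _ q) -qE; ring.
Qed.

Lemma remainder_congr r a b b' l i : (forall j, 'X^l %| b j - b' j) ->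
  'X^l %| remainder r a b i - remainder r a b' i.
Proof.
move=> bb'; rewrite -(@dvdp_mul2l _ ('X^(r + r))) ?expf_neq0 ?polyX_eq0 //.
have : 'X^r * ('X^r * 'X^l) %| peval (glue r a b) (f i) - peval (glue r a b') (f i)
    - \sum_j peval a (f i)^`M(j) * (glue r a b j - glue r a b' j).
  apply: taylor => j; try by rewrite /glue addrC addKr dvdp_mulr.
  rewrite /glue opprD addrACA subrr add0r -mulrBr dvdp_mul2l //.
  by rewrite expf_neq0 ?polyX_eq0.
by rewrite act_taylor !peval_glue mulrA -exprD; congr (_ %| _); ring.
Qed.

Variables (r w : nat) (B : 'I_N -> 'I_m -> {poly k}).

(** The term t B Q(a, b) of the change of variables which linearizes f. *)
Definition correction a b j := 'X * \sum_i B j i * remainder r a b i.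

Lemma correction_congr a b b' l j : (forall j, 'X^l %| b j - b' j) ->
  'X^(l.+1) %| correction a b j - correction a b' j.
Proof.
move=> bb'; rewrite /correction -mulrBr exprS dvdp_mul2l ?polyX_eq0 //.
rewrite -sumrB; apply: dvdp_sumr => i.
by rewrite -mulrBr dvdp_mull // remainder_congr.
Qed.

(** As D(a) (t B) = t^r modulo t^w, the image of the correction under D(a) is
    t^r Q(a, b): after division by t^r, the equation f(a + t^r b) = 0 becomes the
    linear equation for b + t B Q(a, b). *)
Lemma peval_glue_eq0 a b :
    (forall i i0, 'X^w %| 'X * (\sum_j jacobian a i j * B j i0) - unitv r i0 i) ->
    (forall i, 'X^r %| peval a (f i)) ->
  (forall i, 'X^(r + w) %| peval (glue r a b) (f i)) <->
  (forall i, 'X^w %| act (jacobian a) (fun j => b j + correction a b j) i -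
                     - drop_poly r (peval a (f i))).
Proof.
move=> hB ha.
suff E i : 'X^(r + w) %| peval (glue r a b) (f i) =
    ('X^w %| act (jacobian a) (fun j => b j + correction a b j) i -
                     - drop_poly r (peval a (f i))).
  by split=> h i; [rewrite -E | rewrite E].
rewrite peval_glue; have /dvdpP[g gE] := ha i.
pose c i0 := 'X * (\sum_j jacobian a i j * B j i0) - unitv r i0 i.
have -> : act (jacobian a) (fun j => b j + correction a b j) i -
    - drop_poly r (peval a (f i)) =
    (g + act (jacobian a) b i + 'X^r * remainder r a b i) +
    \sum_i0 c i0 * remainder r a b i0.
  rewrite opprK gE drop_polyMXn_id.
  have -> : act (jacobian a) (fun j => b j + correction a b j) i =
      act (jacobian a) b i + act (jacobian a) (correction a b) i.
    by rewrite /act -big_split; apply: eq_bigr => j _; rewrite mulrDr.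
  have -> : \sum_i0 c i0 * remainder r a b i0 =
      act (jacobian a) (correction a b) i - 'X^r * remainder r a b i.
    under eq_bigr do rewrite mulrBl; rewrite sumrB; congr (_ - _).
      rewrite /act /correction.
      under eq_bigr do rewrite mulr_sumr mulr_suml.
      rewrite exchange_big; apply: eq_bigr => j _ /=.
      by rewrite mulrA mulr_sumr; apply: eq_bigr => i0 _; ring.
    rewrite (bigD1 i) //= /unitv eqxx big1 ?addr0 // => i0 /negPf.
    by rewrite eq_sym => ->; rewrite mul0r.
  by ring.
rewrite [RHS]dvdp_addl; last first.
  by apply: dvdp_sumr => i0; apply: dvdp_mulr; exact: hB.
rewrite gE -(@dvdp_mul2l _ ('X^r) ('X^w)) ?expf_neq0 ?polyX_eq0 //.
by rewrite -exprD; congr (_ %| _); rewrite exprD; ring.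
Qed.

End Remainder.

(** * Jets as a fibration in affine spaces *)

Section Fibration.
Variables (k : closedFieldType) (N m n : nat) (f : 'I_m -> {mpoly k[N]}).
Let Y := affine_space k (N * n.+1).
Implicit Types x y : Y.

Definition series x : 'I_N -> {poly k} := jpoly (x : 'rV[k]_(N * n.+1)).

Definition jets : set Y := [set x | forall i, 'X^(n.+1) %| peval (series x) (f i)].

Definition trunc r x : Y := jvec n.+1 (fun i => take_poly r (series x i)).

Lemma jvec_small w (p : 'I_N -> {poly k}) : (forall i, size (p i) <= w)%N ->
  jpoly (jvec w p) = p.
Proof.
move=> sp; apply/funext => i; apply/polyP => l; have [lw|wl] := ltnP l w.
  by rewrite (coef_jpoly _ _ (Ordinal lw)) jvecE.
by rewrite !nth_default // (leq_trans _ wl) // size_jpoly.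
Qed.

Lemma series_trunc r x i : series (trunc r x) i = take_poly r (series x i).
Proof.
rewrite /series /trunc jvec_small // => j; rewrite (leq_trans _ (size_jpoly x j)) //.
have [rs|sr] := leqP r (size (series x j)).
  exact: leq_trans (size_take_poly _ _) rs.
by rewrite take_poly_id // ltnW.
Qed.

Lemma series_inj x y : series x = series y -> x = y.
Proof. by move=> xy; rewrite -[x]jpolyK -[y]jpolyK; congr jvec. Qed.

Lemma trunc_trunc r s x : trunc r (trunc s x) = trunc (minn r s) x.
Proof.
apply: series_inj; apply/funext => i; rewrite !series_trunc.
apply/polyP => l; rewrite !coef_take_poly leq_min.
by case: (l < r)%N => //=; case: (l < s)%N.
Qed.

Lemma trunc_congr r x i : 'X^r %| series (trunc r x) i - series x i.
Proof.
rewrite series_trunc -{2}(poly_take_drop r (series x i)) opprD addrA subrr sub0r.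
by rewrite dvdpNr dvdp_mull.
Qed.

Lemma rpoly_series (Z : space k) (g : Z -> Y) i :
  morphism g -> rpoly (fun z => series (g z) i).
Proof. by move=> /morphism_rmx rg; exact: rpoly_jpoly. Qed.

Lemma morphism_trunc r : morphism (trunc r).
Proof.
apply/morphism_rmx; apply: rmx_jvec => i; apply: rpoly_take.
exact: (rpoly_series _ (@morphism_id _ Y)).
Qed.

Lemma rpoly_jacobian (Z : space k) (g : Z -> Y) i j :
  morphism g -> rpoly (fun z => jacobian f (series (g z)) i j).
Proof. by move=> mg; apply: rpoly_peval => l; exact: rpoly_series. Qed.

Lemma closed_dvdXn (Z : space k) w (F : Z -> 'I_m -> {poly k}) :
  (forall i, rpoly (fun z => F z i)) -> closed [set z | forall i, 'X^w %| F z i].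
Proof.
move=> rF; have := closed_rmx_eq0 (rmx_jvec (w := w) rF); congr closed.
apply/seteqP; split=> z /= => [E i|E].
  have /eq_jvec h : jvec w (F z) = jvec w (fun=> 0) by rewrite jvec0.
  by have := h i; rewrite subr0.
by rewrite -(jvec0 k m w); apply/eq_jvec => i; rewrite subr0.
Qed.

Lemma is_affine_jets (A : set Y) :
  is_affine (restriction A) -> is_affine (restriction (jets `&` A)).
Proof.
move=> affA.
have rf i : rpoly (fun a : restriction A => peval (series (val a)) (f i)).
  by apply: rpoly_peval => l; apply: rpoly_series; exact: morphism_val.
apply: is_affine_iso (is_affine_closed affA (closed_dvdXn (w := n.+1) rf)).
by rewrite setIC; apply: isomorphic_sym; exact: restriction_restriction.
Qed.

Lemma mx_regular_on_jmx w r (A : set Y) :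
  mx_regular_on A (fun a => jmx w (jacobian f (series (trunc r a)))).
Proof.
apply: rmx_jmx => i j.
apply: (@rpoly_jacobian _ (fun a : restriction A => trunc r (val a))).
exact: morphism_comp (morphism_val A) (morphism_trunc r).
Qed.

(** In this section A is a union of fibers of the truncation at order r, and the
    base is its set A0 of truncated jets at which f vanishes modulo t^r.  The
    hypothesis on B is the one under which the equations can be linearized; it
    holds for B = 0 as soon as w <= r. *)
Section Step.
Variables (r w rho e : nat) (A : set Y) (B : Y -> 'I_N -> 'I_m -> {poly k}).
Hypothesis rw : (r + w = n.+1)%N.
Hypothesis affA : is_affine (restriction A).
Hypothesis invA : invariant_set (trunc r) A.
Hypothesis regB : forall (Z : space k) (g : Z -> Y), morphism g ->
  (forall z, A (g z)) -> forall j i, rpoly (fun z => B (g z) j i).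
Hypothesis hB : forall a, A a -> trunc r a = a -> forall i i0,
  'X^w %| 'X * (\sum_j jacobian f (series a) i j * B a j i0) - unitv r i0 i.

Let M a := jmx w (jacobian f (series (trunc r a))).
Hypothesis gaussM : gauss_on A M rho.
Hypothesis rho_le : (rho + e <= N * w)%N.

Let c a := - jvec w (fun i => drop_poly r (peval (series (trunc r a)) (f i))).

Let A0 := A `&` [set a | trunc r a = a /\
  forall i, 'X^r %| peval (series a) (f i)].

Let E : set (product Y (affine_space k (N * w))) :=
  [set z | A0 z.1 /\ (z.2 : 'rV[k]_(N * w)) *m M z.1 = c z.1].

(** Multiplication by t in the correction makes phi a a contraction in b. *)
Let phi a (b : 'rV[k]_(N * w)) : 'rV[k]_(N * w) :=
  jvec w (correction f r (B a) (series a) (jpoly b)).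

Let phi_contr a l (b b' : 'rV[k]_(N * w)) : (l < w)%N ->
  (forall j, 'X^l %| jpoly b j - jpoly b' j) ->
  forall j, 'X^(l.+1) %| jpoly (phi a b) j - jpoly (phi a b') j.
Proof.
move=> lw bb' j.
have d (p : 'I_N -> {poly k}) i : 'X^(l.+1) %| jpoly (jvec w p) i - p i.
  by apply: dvdp_trans (jvecK w p i); rewrite -(subnK lw) exprD dvdp_mull.
rewrite /phi; set p := correction _ _ _ _ _; set p' := correction _ _ _ _ _.
rewrite (_ : _ - _ = (jpoly (jvec w p) j - p j) + (p j - p' j) -
  (jpoly (jvec w p') j - p' j)); last by ring.
by rewrite dvdp_sub // dvdp_add // correction_congr.
Qed.

Let jdrop x : 'rV[k]_(N * w) := jvec w (fun j => drop_poly r (series x j)).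
Let join a (b : 'rV[k]_(N * w)) : Y :=
  jvec n.+1 (glue r (series a) (jpoly b)).

Let jpoly_jdrop x : jpoly (jdrop x) = fun j => drop_poly r (series x j).
Proof.
by apply: jvec_small => j; rewrite size_drop_poly leq_subLR rw size_jpoly.
Qed.

Let series_small a j : trunc r a = a -> (size (series a j) <= r)%N.
Proof. by move=> <-; rewrite series_trunc size_take_poly. Qed.

Let series_join a b : trunc r a = a ->
  series (join a b) = glue r (series a) (jpoly b).
Proof.
move=> ta; apply: jvec_small => j; rewrite /glue.
rewrite (leq_trans (size_polyD _ _)) // geq_max; apply/andP; split.
  by rewrite (leq_trans (series_small j ta)) // -rw leq_addr.
rewrite mulrC (leq_trans (size_polyMleq _ _)) // size_polyXn addnS /= -rw addnC.
by rewrite leq_add2l size_jpoly.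
Qed.

Let trunc_join a b : trunc r a = a -> trunc r (join a b) = a.
Proof.
move=> ta; apply: series_inj; apply/funext => j.
rewrite series_trunc series_join // /glue mulrC take_polyDMXn //.
exact: series_small.
Qed.

Let jdrop_join a b : trunc r a = a -> jdrop (join a b) = b.
Proof.
move=> ta; rewrite -[RHS]jpolyK; apply/eq_jvec => j.
rewrite series_join // /glue mulrC drop_polyDMXn ?subrr ?dvdp0 //.
exact: series_small.
Qed.

Let join_trunc x : join (trunc r x) (jdrop x) = x.
Proof.
apply: series_inj; rewrite series_join ?trunc_trunc ?minnn //.
apply/funext => j; rewrite /glue jpoly_jdrop series_trunc mulrC.
exact: poly_take_drop.
Qed.

Let jets_join a b : A0 a -> jets (join a b) <-> E (a, b + phi a b).
Proof.
move=> A0a; have [Aa [ta fa]] := A0a.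
have J : jets (join a b) <->
    forall i, 'X^(r + w) %| peval (glue r (series a) (jpoly b)) (f i).
  by rewrite rw /jets /= series_join.
apply: (iff_trans J); rewrite (peval_glue_eq0 (B := B a)) //; last first.
  by move=> i i0; exact: hB.
rewrite /E /= /M /c ta.
rewrite -(_ : jvec w (act (jacobian f (series a))
   (fun j => jpoly b j + correction f r (B a) (series a) (jpoly b) j)) =
   (b + phi a b) *m jmx w (jacobian f (series a))); last first.
  rewrite -jvec_jmx; congr (_ *m _).
  rewrite -[X in X + _]jpolyK -[X in X + _]scale1r -jvecP; apply/eq_jvec => j.
  by rewrite scale1r subrr dvdp0.
rewrite -[- jvec _ _]addr0 -scaleN1r -(jvec0 k m w) -jvecP.
split=> [h|[_ /eq_jvec h] i]; last by have := h i; rewrite scaleN1r addr0.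
by split=> //; apply/eq_jvec => i; rewrite scaleN1r addr0.
Qed.

Let A0_trunc x : jets x -> A x -> A0 (trunc r x).
Proof.
move=> jx Ax; split; first by apply/invA.
split; first by rewrite trunc_trunc minnn.
move=> i; rewrite -[X in _ %| X](subrK (peval (series x) (f i))) dvdp_add //.
  by apply: peval_congr => j; exact: trunc_congr.
by apply: dvdp_trans (jx i); rewrite -rw exprD dvdp_mulr.
Qed.

Let rmx_phi (Z : space k) (g : Z -> Y) (b : Z -> 'rV[k]_(N * w)) :
  morphism g -> (forall z, A (g z)) -> rmx b -> rmx (fun z => phi (g z) (b z)).
Proof.
move=> mg Ag rb; apply: rmx_jvec => j; apply: rpolyM (rpoly_cst _) _.
apply: rpoly_sum => i; apply: rpolyM; first exact: regB.
have rs l : rpoly (fun z => series (g z) l) by exact: rpoly_series.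
have rj l : rpoly (fun z => jpoly (b z) l) by exact: rpoly_jpoly.
apply: rpoly_drop; apply: rpolyB; first apply: rpolyB.
- apply: rpoly_peval => l; apply: rpolyD => //.
  exact: rpolyM (rpoly_cst _) (rj l).
- exact: rpoly_peval.
- apply: rpolyM (rpoly_cst _) _; apply: rpoly_act => // i' j'.
  exact: rpoly_jacobian.
Qed.

(** The map x |-> (a, b + phi a b), where x = a + t^r b, identifies the jets of X in
    A with the solutions of a linear system over A0. *)
Lemma jets_fibration : divisible e (restriction (jets `&` A)).
Proof.
have affA0 : is_affine (restriction A0).
  have rt : rmx (fun a : restriction A => trunc r (val a) - val a).
    apply: rmxB; apply/morphism_rmx; last exact: morphism_val.
    exact: morphism_comp (morphism_val A) (morphism_trunc r).
  have rf i : rpoly (fun a : restriction A => peval (series (val a)) (f i)).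
    by apply: rpoly_peval => l; apply: rpoly_series; exact: morphism_val.
  have cA := closedI (closed_rmx_eq0 rt) (closed_dvdXn (w := r) rf).
  apply: is_affine_iso (is_affine_closed affA cA).
  apply: isomorphic_sym; apply: restriction_restriction => a.
  by split=> [[/= /subr0_eq ta fa]|[/= ta fa]]; split=> //=; rewrite ta subrr.
have affE : divisible e (restriction E).
  have [rL rU rr] := gaussM.
  apply: (linear_fibration affA0 _ _ rho_le).
    have sA : A0 `<=` A by move=> a [].
    split; last by move=> a /sA; exact: rr.
      exact: (mx_regular_onS (M := fun a => col_ebase (M a)) sA rL).
    exact: (mx_regular_onS (M := fun a => row_ebase (M a)) sA rU).
  apply: rmxN; apply: rmx_jvec => i; apply: rpoly_drop; apply: rpoly_peval => l.
  apply: rpoly_series; exact: morphism_comp (morphism_val _) (morphism_trunc r).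
apply: divisible_iso (is_affine_jets affA) affE.
pose EY := product Y (affine_space k (N * w)).
apply: (@isomorphic_sub _ EY Y E (jets `&` A)
  (fun z : restriction E => join (val z).1 (solve (phi (val z).1) (val z).2))
  (fun x : restriction (jets `&` A) => (trunc r (val x),
     jdrop (val x) + phi (trunc r (val x)) (jdrop (val x))) : EY)).
- have mg : morphism (fun z : restriction E => (val z).1 : Y).
    exact: morphism_comp (morphism_val E) (morphism_fst _ _).
  have Ag (z : restriction E) : A (val z).1 by have [[]] := set_valP z.
  have rb' : rmx (fun z : restriction E => (val z).2 : 'rV_(N * w)).
    by apply/morphism_rmx; exact: morphism_comp (morphism_val E) (morphism_snd _ _).
  have rsolve : rmx (fun z : restriction E => solve (phi (val z).1) (val z).2).
    suff riter l : rmx (fun z : restriction E =>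
        iter l (fun b => (val z).2 - phi (val z).1 b) 0) by exact: riter.
    elim: l => [|l ih]; first exact: rmx_cst.
    by apply: rmxB => //; exact: rmx_phi.
  apply/morphism_rmx; apply: rmx_jvec => i; apply: rpolyD.
    exact: rpoly_series.
  exact: rpolyM (rpoly_cst _) (rpoly_jpoly _ rsolve).
- have mg : morphism (fun x : restriction (jets `&` A) => trunc r (val x)).
    exact: morphism_comp (morphism_val _) (morphism_trunc r).
  have Ag (x : restriction (jets `&` A)) : A (trunc r (val x)).
    by apply/invA; have [] := set_valP x.
  have rd : rmx (fun x : restriction (jets `&` A) => jdrop (val x)).
    apply: rmx_jvec => i; apply: rpoly_drop; apply: rpoly_series.
    exact: morphism_val.
  apply: morphism_to_product => //; apply/morphism_rmx; apply: rmxD => //.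
  exact: rmx_phi.
- move=> z; have [A0z Ez] := set_valP z; have [Az [tz fz]] := A0z.
  split; last by apply/invA; rewrite trunc_join.
  apply/jets_join => //; rewrite solveP //; first exact: phi_contr.
- move=> x; have [jx Ax] := set_valP x; have A0x := A0_trunc jx Ax.
  by apply/jets_join => //; rewrite join_trunc.
- move=> z x ->; have [[Az [tz fz]] Ez] := set_valP z.
  rewrite trunc_join // jdrop_join // solveP; last exact: phi_contr.
  by case: (\val z).
- move=> x z ->.
  by rewrite /= solveK ?join_trunc //; exact: phi_contr.
Qed.

End Step.
End Fibration.
Arguments morphism_trunc {k N n}.

(** * Stratification by the order of the Jacobian matrix *)

Section Stratification.
Variables (k : closedFieldType) (N m n : nat) (f : 'I_m -> {mpoly k[N]}).
Let Y := affine_space k (N * n.+1).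
Implicit Types x y : Y.

Let D x := jacobian f (series x).

Lemma invariant_trunc r s (A : set Y) : (r <= s)%N ->
  invariant_set (trunc r) A -> invariant_set (trunc s) A.
Proof. by move=> rs iA y; rewrite -iA trunc_trunc (minn_idPl rs) iA. Qed.

Lemma kills_coker_trunc e r x : (e < r)%N ->
  kills_coker (D (trunc r x)) e = kills_coker (D x) e.
Proof.
move=> er; have DD : jmx e.+1 (D (trunc r x)) = jmx e.+1 (D x).
  apply: jmx_congr => i j; apply: peval_congr => l.
  by apply: dvdp_trans (trunc_congr r x l); rewrite dvdp_exp2l.
by rewrite /kills_coker DD.
Qed.

(** The matrix B of [jets_fibration] is obtained by solving D(a) B = p, for a p with
    t p = t^r modulo t^w; the partial inverse given by Gaussian elimination makes
    the solution regular in a on each piece of a cut. *)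
Lemma divisible_jets_solvable r w e (A : set Y) (p : 'I_m -> 'I_m -> {poly k}) :
    (r + w = n.+1)%N -> is_affine (restriction A) -> invariant_set (trunc r) A ->
    (forall i i0, 'X^w %| 'X * p i0 i - unitv r i0 i) ->
    (forall a i0, A a -> (jvec w (p i0) <= jmx w (D (trunc r a)))%MS) ->
    (forall a, A a -> (\rank (jmx w (D (trunc r a))) + e <= N * w)%N) ->
  divisible e (restriction (jets f `&` A)).
Proof.
move=> rw affA invA pP pD rankD.
pose M a := jmx w (D (trunc r a)).
have affJ := is_affine_jets f affA.
have rM : mx_regular_on A M by exact: mx_regular_on_jmx.
have iM y : M (trunc r y) = M y by rewrite /M trunc_trunc minnn.
apply: (divisible_cut affA invA affJ).
apply: cut_weaken (cut_gauss rM iM) => C CA [rho gC] affC invC affJC.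
have [[x Cx]|C0] := pselect (exists x, C x); last first.
  by apply: divisible_empty => // x; apply: C0; exists (val x); have [] := set_valP x.
pose B a j i0 := jpoly (jvec w (p i0) *m pinvmx (M a)) j.
apply: (jets_fibration (B := B) rw affC invC _ _ gC); last first.
- by have [_ _ rr] := gC; rewrite -(rr x Cx); exact/rankD/CA.
- move=> a Ca ta i i0.
  have Bp : 'X^w %| act (D a) (fun j => B a j i0) i - p i0 i.
    have sub_p : (jvec w (p i0) <= jmx w (D a))%MS.
      by rewrite -{1}ta; exact/pD/CA.
    by apply/eq_jvec: i; rewrite -mul_jmx /M ta mulmxKpV.
  rewrite (_ : _ - _ = 'X * (act (D a) (fun j => B a j i0) i - p i0 i) +
    ('X * p i0 i - unitv r i0 i)); last by rewrite /act; ring.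
  by rewrite dvdp_add // dvdp_mull.
- move=> Z g mg Cg j i; apply: rpoly_jpoly; apply: rmxM; first exact: rmx_cst.
  have [rL rU rr] := gC.
  have rLg := mx_regular_on_comp mg Cg rL; have rUg := mx_regular_on_comp mg Cg rU.
  apply: (rmx_ext (N := fun z => invmx (row_ebase (M (g z))) *m pid_mx rho *m
    invmx (col_ebase (M (g z))))); first by move=> z; rewrite /pinvmx rr.
  apply: rmxM; first apply: rmxM (rmx_cst _).
    by apply: rmx_invmx => // z; exact: row_ebase_unit.
  by apply: rmx_invmx => // z; exact: col_ebase_unit.
Qed.

Hypothesis mN : (m < N)%N.

(** The fibers have dimension N w - rank, and the rank is at most m w - e. *)
Let rank_bound e r w a : (e <= r)%N -> (e <= w)%N ->
    ((0 < e)%N -> ~~ kills_coker (D a) e.-1) ->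
    (uphalf ((N - m + 1) * n) <= (N - m) * w + e)%N ->
  (\rank (jmx w (D (trunc r a))) + uphalf ((N - m + 1) * n) <= N * w)%N.
Proof.
move=> er ew he le.
have rk : (\rank (jmx w (D (trunc r a))) + e <= m * w)%N.
  case: e er ew he {le} => [|e] er ew he; first by rewrite addn0 rank_leq_col.
  by apply: rank_jmx_lt => //; rewrite kills_coker_trunc //; exact: he.
have Nw : (m * w + (N - m) * w = N * w)%N by rewrite -mulnDl subnKC // ltnW.
apply: leq_trans (eq_leq Nw); apply: leq_trans (leq_add (leqnn _) le) _.
by rewrite addnCA addnC leq_add2r.
Qed.

(** By descending induction on e, on sets where t^(e-1) does not kill the cokernel
    of the Jacobian matrix.  Such a set is cut according to whether t^e kills it.
    Where it does, r = e+1 can be used; elsewhere the induction hypothesis applies,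
    until e reaches half of n+1, where B = 0 is possible. *)
Lemma divisible_stratum e (A : set Y) :
    (e <= n.+1./2)%N -> is_affine (restriction A) -> invariant_set (trunc e) A ->
    (forall x, A x -> (0 < e)%N -> ~~ kills_coker (D x) e.-1) ->
  divisible (uphalf ((N - m + 1) * n)) (restriction (jets f `&` A)).
Proof.
set s := n.+1./2 => es; rewrite -(subKn es); move: (s - e)%N (leq_subr e s) => d.
elim: d A => [|d ih] A ds affA invA nkills.
  rewrite subn0 in invA nkills *.
  have sn : (s + s <= n.+1)%N by rewrite addnn /s; lia.
  apply: (@divisible_jets_solvable (n.+1 - s) s _ A (fun _ _ => 0)) => //.
  - by lia.
  - by apply: invariant_trunc invA; lia.
  - move=> i i0; rewrite mulr0 sub0r dvdpNr /unitv; case: ifP; rewrite ?dvdp0 // => _.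
    by rewrite dvdp_exp2l //; lia.
  - by move=> a i0 _; rewrite jvec0 sub0mx.
  - move=> a Aa; apply: (@rank_bound s) => //; [by lia|exact: nkills|].
    rewrite leq_uphalf_double -mulSnr -muln2 -mulnA muln2 addn1 leq_mul2l; apply/orP; right.
    by rewrite /s; lia.
have [e' e'E] : exists e', (s - d.+1)%N = e' by eexists.
have sd : (s - d)%N = e'.+1 by lia.
rewrite e'E in invA nkills; rewrite sd in ih; have {}ih B := ih B (ltnW ds).
have es' : (e' < s)%N by lia.
have en : (e'.*2 < n)%N by rewrite /s in es'; lia.
have invA' := invariant_trunc (leqnSn _) invA.
have affJ := is_affine_jets f affA.
pose M a := jmx e'.+1 (D (trunc e'.+1 a)).
have rM : mx_regular_on A M by exact: mx_regular_on_jmx.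
have iM y : M (trunc e'.+1 y) = M y by rewrite /M trunc_trunc minnn.
apply: (divisible_cut affA invA' affJ).
apply: cut_bind (cut_sub (cut_gauss rM iM)) _ => C [[rho [rL rU rr]] CA].
pose F (z : 'I_m * 'I_(m * e'.+1)) y : k :=
  (jvec e'.+1 (unitv e' z.1) *m cokermx (M y)) 0 z.2.
have rF z : regular_on C (F z).
  have rcok : mx_regular_on C (fun y => cokermx (M y)).
    apply: (rmx_ext (N := fun a : restriction C =>
      invmx (row_ebase (M (val a))) *m copid_mx rho)).
      by move=> a; rewrite /cokermx rr //; exact: set_valP.
    by apply: rmxM (rmx_cst _); apply: rmx_invmx => // a; exact: row_ebase_unit.
  by have := rmxM (rmx_cst (jvec e'.+1 (unitv e' z.1))) rcok; apply.
have killsE y : kills_coker (D y) e' <-> forall z, F z y = 0.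
  rewrite -(@kills_coker_trunc _ e'.+1) // /kills_coker.
  split=> [/forallP h [i0 c]|F0].
    by have := h i0; rewrite submxE /F => /eqP ->; rewrite mxE.
  apply/forallP => i0; rewrite submxE; apply/eqP/rowP => c.
  by rewrite [RHS]mxE; exact: (F0 (i0, c)).
apply: cut_weaken (cut_family rF _); last by move=> z y; rewrite /F iM.
move=> B BC FB affB invB affJB.
have BA : B `<=` A := subset_trans BC CA.
have [[z Fz]|nF] := pselect (exists z, forall y, B y -> F z y <> 0).
  apply: ih => // y By _; apply/negP => /killsE /(_ z); exact: Fz.
have hB y : B y -> kills_coker (D y) e'.
  move=> By; apply/killsE => z; case: (FB z) => [->//|Fz].
  by case: nF; exists z.
apply: (@divisible_jets_solvable e'.+1 (n - e') _ B (unitv e')) => //.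
- by lia.
- move=> i i0; rewrite /unitv; case: ifP => _; rewrite ?mulr0 ?exprS subrr dvdp0 //.
- move=> a i0 Ba; apply/sub_jmx; apply: kills_coker_lift.
  by rewrite kills_coker_trunc // hB.
- move=> a Ba; apply: (@rank_bound e') => //; first by lia.
    exact/nkills/BA.
  rewrite leq_uphalf_double.
  (* 2 ((N-m) (n-e') + e') - (N-m+1) n = (N-m-1) (n-2e') *)
  have [c cE] : exists c, n = (e'.*2.+1 + c)%N by exists (n - e'.*2.+1)%N; lia.
  have [b bE] : exists b, (N - m = b.+1)%N by exists (N - m).-1; lia.
  rewrite bE cE; nia.
Qed.

End Stratification.

(** * The jet scheme *)

Lemma rmorph_mmap d (A S T : comNzRingType) (theta : {rmorphism S -> T})
    (h : A -> S) (x : 'I_d -> S) (p : {mpoly A[d]}) :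
  theta (mmap h x p) = mmap (theta \o h) (theta \o x) p.
Proof.
rewrite /mmap rmorph_sum; apply: eq_bigr => m _.
rewrite rmorphM rmorph_prod; congr (_ * _).
by apply: eq_bigr => i _; rewrite rmorphXn.
Qed.

Lemma jet_series (k : closedFieldType) N n (x : affine_space k (N * n.+1)) i :
  jet (fun ij => (x : 'rV[k]_(N * n.+1)) 0 ij) i = series x i.
Proof.
apply/polyP => l; have [ln|nl] := ltnP l n.+1.
  rewrite (coef_jpoly _ _ (Ordinal ln)) /jet coef_sum (bigD1 (Ordinal ln)) //=.
  rewrite coefCM coefXn eqxx mulr1 big1 ?addr0 // => j.
  by rewrite -(inj_eq val_inj) /= eq_sym coefCM coefXn => /negPf ->; rewrite mulr0.
rewrite [RHS]nth_default ?(leq_trans (size_jpoly _ _)) // /jet coef_sum big1 //.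
move=> j _; rewrite coefCM coefXn gtn_eqF ?mulr0 //.
exact: leq_trans (ltn_ord j) nl.
Qed.

(** The equations of the jet scheme, evaluated at a k-point, are the coefficients of
    the equations of X evaluated at the corresponding vector of series. *)
Lemma coef_peval_series (k : closedFieldType) N n (x : affine_space k (N * n.+1)) p l :
  mmap idfun ((x : 'rV[k]_(N * n.+1)) 0)
    (mmap (polyC \o @mpolyC _ k) (jet (fun i => 'X_i)) p)`_l =
  (peval (series x) p)`_l.
Proof.
pose ev : {rmorphism {mpoly k[N * n.+1]} -> k} :=
  mmap idfun ((x : 'rV[k]_(N * n.+1)) 0).
rewrite -[LHS](coef_map ev) rmorph_mmap; congr (_ `_ l).
rewrite (_ : _ \o _ = @polyC k); last first.
  by apply/funext => a; rewrite /= map_polyC /= mmapC.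
rewrite (_ : _ \o _ = series x) //; apply/funext => i.
rewrite -jet_series /= /jet rmorph_sum; apply: eq_bigr => j _.
by rewrite rmorphM /= map_polyC /= map_polyXn mmapX mmap1U.
Qed.

Lemma reduced_pts_jet (k : closedFieldType) N m n (X : subscheme k N)
    (f : 'I_m -> {mpoly k[N]}) : ideal X = ideal_gen (range f) ->
  reduced_pts (jet_scheme n X) = jets f.
Proof.
move=> Xf; apply/seteqP; split=> x.
  move=> Jx i; apply/dvdXnP => l; rewrite ltnS => ln; rewrite -coef_peval_series.
  apply: Jx => J _; apply; exists (f i); last by exists l.
  by rewrite Xf => I _; apply; exists i.
pose ev : {rmorphism {mpoly k[N * n.+1]} -> k} :=
  mmap idfun ((x : 'rV[k]_(N * n.+1)) 0).
move=> fx q /(_ [set q | ev q = 0]); apply.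
  split=> [|p r p0 r0|p r r0] /=.
  - exact: rmorph0.
  - by rewrite rmorphD [ev p]p0 [ev r]r0 addr0.
  - by rewrite rmorphM [ev r]r0 mulr0.
move=> _ [p Xp [l ln ->]]; apply: etrans (coef_peval_series _ _ _) _.
suff /dvdXnP -> // : 'X^(n.+1) %| peval (series x) p by [].
move: Xp; rewrite Xf => /(_ [set p | 'X^(n.+1) %| peval (series x) p]); apply.
  split=> [|p1 p2 h1 h2|p1 p2 h2] /=.
  - by rewrite rmorph0 dvdp0.
  - by rewrite rmorphD dvdp_add.
  - by rewrite rmorphM dvdp_mull.
by move=> _ [i _ <-]; exact: fx.
Qed.

Theorem theorem4 (k : closedFieldType) (N m n : nat) (X : subscheme k N)
    (hm : (m < N)%N)
    (hX : exists f : 'I_m -> {mpoly k[N]}, ideal X = ideal_gen (range f)) :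
  exists a : K0 k, K0_class (reduced (jet_scheme n X)) =
    K0_mul a (K0_exp (lefschetz k) (uphalf ((N - m + 1) * n)%N)).
Proof.
have [f Xf] := hX.
have aT : is_affine (restriction [set: affine_space k (N * n.+1)]).
  exact: is_affine_iso (restrictionT (erefl _)) (is_affine_affine_space k _).
have [||vJ [a aE]] := divisible_stratum (n := n) (f := f) hm (leq0n _) aT.
- by move=> y.
- by [].
exists a; rewrite -aE; apply: K0_class_iso => /=.
rewrite (reduced_pts_jet n Xf) -{1}[jets f]setIT; exact: isomorphic_refl.
Qed.
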